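(* Let $K$ be a compact space and let $\alpha$ be a countable ordinal. Then the following three cardinal numbers coincide: \begin{enumerate} \item[(1)] $c(K^{(\alpha)},K)$; \item[(2)] $\sup\{|\Gamma| : C(K_{\Gamma,[1,\omega^\alpha]})\text{ embeds positively isometrically into }C(K)\}$; \item[(3)] $\sup\{|\Gamma| : C(K_{\Gamma,[1,\omega^\alpha]})\text{ embeds isometrically into }C(K)\}$. \end{enumerate} If, moreover, $K$ is zero-dimensional, then the three cardinal numbers (1), (2) and (3) coincide also with the following two: \begin{enumerate} \item[(4)] $\sup\{|\Gamma| : K\text{ maps continuously onto }K_{\Gamma,[1,\omega^\alpha]}\}$; \item[(5)] $\sup\{|\Gamma| : C(K_{\Gamma,[1,\omega^\alpha]})\text{ embeds lattice and algebraically isometrically into }C(K)\}$. \end{enumerate}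
   Context: All compact spaces are Hausdorff (and nonempty, since Banach spaces are assumed real and of dimension at least one). A space is zero-dimensional if it has a base of clopen sets. $C(K)$ is the Banach space of continuous real-valued functions on $K$ with the supremum norm, and is a Banach lattice and Banach algebra with pointwise operations. Isometric embeddings are linear; a positive isometric embedding is one mapping nonnegative functions to nonnegative functions; a lattice and algebraically isometric embedding is an isometric embedding which also preserves the lattice operations and multiplication. Cantor--Bendixson derivatives: $S^{(0)}=S$, $S^{(1)}$ is the set of accumulation points of $S$, $S^{(\beta+1)}=(S^{(\beta)})^{(1)}$, and $S^{(\alpha)}=\bigcap_{\beta<\alpha}S^{(\beta)}$ for limit $\alpha$. A cellular family in $S$ is a family of pairwise disjoint nonempty open subsets of $S$. For $A\subseteq S$, the relative cellularity $c(A,S)$ is the supremum of the cardinalities of cellular families $\mathcal U$ in $S$ such that $A\cap U\ne\emptyset$ for every $U\in\mathcal U$. $[1,\omega^\alpha]$ is the ordinal interval with the order topology (ordinal exponentiation). For a nonempty set $\Gamma$ and a nonempty compact space $L$, $K_{\Gamma,L}$ is the one-point compactification of the disjoint union of $|\Gamma|$ many copies of $L$ if $\Gamma$ is infinite, and simply the disjoint union of $|\Gamma|$ copies of $L$ if $\Gamma$ is finite. Suprema are over nonempty sets $\Gamma$, and the supremum of the empty set is $0$. *)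

(* Defs.v *)
From HB Require Import structures.
From mathcomp Require Import all_boot all_order all_algebra generic_quotient.
From mathcomp Require Import all_classical all_reals all_analysis.
Import Order.TTheory GRing.Theory Num.Theory.
Import numFieldNormedType.Exports.

Set Implicit Arguments.
Unset Strict Implicit.
Unset Printing Implicit Defensive.

Local Open Scope classical_set_scope.
Local Open Scope card_scope.
Local Open Scope ring_scope.
Local Open Scope quotient_scope.

(* Notations for countable ordinals: [OZero] denotes 0 and [OSup f] denotes
   sup_n (f n + 1); every countable ordinal has a notation, in general several.
   The type [omega1] of countable ordinals is the quotient identifying
   notations of the same ordinal, see [omega1_countable_segment] and
   [omega1_bounded] below. *)
Inductive onote : Type := OZero | OSup of (nat -> onote).

Fixpoint onote_le (s t : onote) : Prop :=
  match s, t with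
  | OZero, _ => True
  | OSup _, OZero => False
  | OSup f, OSup g => forall n, exists m, onote_le (f n) (g m)
  end.

Definition onote_lt (s t : onote) : Prop :=
  if t is OSup g then exists m, onote_le s (g m) else False.

HB.instance Definition _ := gen_eqMixin onote.
HB.instance Definition _ := gen_choiceMixin onote.

Lemma onote_le_refl s : onote_le s s.
Proof. by elim: s => //= f IH n; exists n. Qed.

Lemma onote_le_trans t s u : onote_le s t -> onote_le t u -> onote_le s u.
Proof.
elim: s t u => [|f IH] [|g] [|h] //= st tu n.
by have [m fg] := st n; have [k gh] := tu m; exists k; exact: IH fg gh.
Qed.

Lemma onote_le_sup f t :
  onote_le (OSup f) t <-> forall n, onote_lt (f n) t.
Proof. by case: t => //=; split=> // /(_ 0%N). Qed.

Lemma onote_lt_le s t : onote_lt s t -> onote_le s t.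
Proof.
elim: s t => [//|f IH] [|g] //= -[m sg] n; exists m.
exact/IH/(onote_le_sup f (g m)).1.
Qed.

Lemma onote_le_or_lt s t : onote_le s t \/ onote_lt t s.
Proof.
elim: s t => [|f IH] t; first by left.
have [|/existsNP[n fn]] := pselect (forall n, onote_lt (f n) t).
  by move/onote_le_sup; left.
right; exists n; case: t fn => [//|g] fn; apply/onote_le_sup => k.
by have [gk|//] := IH n (g k); exfalso; apply: fn; exists k.
Qed.

Lemma onote_lt_irrefl s : ~ onote_lt s s.
Proof.
elim: s => [//|f IH] /= [m fm]; apply: (IH m).
exact: (onote_le_sup f (f m)).1.
Qed.

Lemma onote_lt_le_trans s t u : onote_lt s t -> onote_le t u -> onote_lt s u.
Proof.
case: t => [//|g] [m sg] /onote_le_sup/(_ m).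
by case: u => [//|h] [k gh]; exists k; exact: onote_le_trans gh.
Qed.

Lemma onote_lt_wf : well_founded onote_lt.
Proof.
suff acc t s : onote_le s t -> Acc onote_lt s by move=> t; exact/acc/onote_le_refl.
elim: t s => [|g IH] s st; constructor => r rs.
  by have := onote_lt_le_trans rs st.
by have [m rg] := onote_lt_le_trans rs st; exact: (IH m).
Qed.

Definition onote_eq (s t : onote) : bool := `[< onote_le s t /\ onote_le t s >].

Lemma onote_eq_equiv : equiv_class_of onote_eq.
Proof.
constructor=> [s|s t|t s u].
- by apply/asboolP; split; exact: onote_le_refl.
- by apply/asboolP/asboolP => -[].
- move=> /asboolP[st ts] /asboolP[tu ut]; apply/asboolP.
  by split; [exact: onote_le_trans tu|exact: onote_le_trans ts].
Qed.

Canonical onote_eq_rel := EquivRelPack onote_eq_equiv.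

Definition omega1 : Type := {eq_quot onote_eq}.
HB.instance Definition _ := Choice.on omega1.
HB.instance Definition _ := EqQuotient.on omega1.

Definition omega1_le (a b : omega1) : bool := `[< onote_le (repr a) (repr b) >].

Lemma omega1_le_refl : reflexive omega1_le.
Proof. by move=> a; apply/asboolP; exact: onote_le_refl. Qed.

Lemma omega1_le_anti : antisymmetric omega1_le.
Proof.
move=> a b /andP[/asboolP ab /asboolP ba].
by rewrite -[a]reprK -[b]reprK; apply/eqmodP/asboolP.
Qed.

Lemma omega1_le_trans : transitive omega1_le.
Proof.
by move=> b a c /asboolP ab /asboolP bc; apply/asboolP; exact: onote_le_trans bc.
Qed.

Lemma omega1_le_total : total omega1_le.
Proof.
move=> a b; have [ab|/onote_lt_le ba] := onote_le_or_lt (repr a) (repr b).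
  by apply/orP; left; apply/asboolP.
by apply/orP; right; apply/asboolP.
Qed.

Fact omega1_display : Order.disp_t. Proof. exact: Order.Disp tt tt. Qed.

HB.instance Definition _ := Order.Le_isPOrder.Build omega1_display omega1
  omega1_le_refl omega1_le_anti omega1_le_trans.
HB.instance Definition _ := Order.POrder_isTotal.Build omega1_display omega1
  omega1_le_total.

Section ordinals.
Implicit Types a b c : omega1.

Lemma omega1_leP a b : (a <= b)%O <-> onote_le (repr a) (repr b).
Proof. by split=> /asboolP. Qed.

Lemma omega1_ltP a b : (a < b)%O <-> onote_lt (repr a) (repr b).
Proof.
rewrite ltNge; split=> [/negP ba|ab].
  have [/omega1_leP//|//] := onote_le_or_lt (repr b) (repr a).
apply/negP => /omega1_leP ba.
exact: onote_lt_irrefl (onote_lt_le_trans ab ba).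
Qed.

Lemma omega1_wf : well_founded (fun a b => (a < b)%O).
Proof.
suff acc s a : repr a = s -> Acc (fun a b => (a < b)%O) a by move=> a; exact: acc.
elim/(well_founded_ind onote_lt_wf): s a => s IH a as_.
by constructor=> b /omega1_ltP ba; apply: IH (erefl _); rewrite -as_.
Qed.

Lemma repr_piK s : onote_le (repr (\pi_omega1 s)) s /\ onote_le s (repr (\pi_omega1 s)).
Proof. by apply/asboolP/(eqmodP onote_eq_rel); rewrite reprK. Qed.

(* The next two facts characterize omega1 among well-ordered types. *)
Lemma omega1_countable_segment a : countable [set b | (b < a)%O].
Proof.
pose g (n : nat) : omega1 :=
  if repr a is OSup f then \pi_omega1 (f n) else a.
elim/(well_founded_ind omega1_wf): a @g => a IH g.
have sub : [set b | (b < a)%O] `<=`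
    \bigcup_n ([set g n | _ in [set: unit]] `|` [set b | (b < g n)%O /\ (g n < a)%O]).
  move=> b /= ba; move: (ba) => /omega1_ltP; rewrite /g.
  case E: (repr a) => [//|f] [n bn]; exists n => //=.
  have : (b <= \pi_omega1 (f n))%O.
    by apply/omega1_leP/(onote_le_trans bn); case: (repr_piK (f n)).
  rewrite le_eqVlt => /orP[/eqP ->|bp]; first by left; exists tt.
  right; split=> //; apply/omega1_ltP; rewrite E.
  by exists n; case: (repr_piK (f n)).
apply: sub_countable (subset_card_le sub) _.
apply: bigcup_countable => // n _; rewrite -bigcup2E.
apply: bigcup_countable => // -[|[|k]] _ /=; last exact: countable0.
  by apply: sub_countable (countable1 (g n)); apply: subset_card_le => b [].
have [ga|nga] := pselect (g n < a)%O.
  by apply: sub_countable (IH _ ga); apply: subset_card_le => b [].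
by apply: sub_countable (countable0 omega1); apply: subset_card_le => b [].
Qed.

Lemma omega1_bounded (A : set omega1) : countable A -> exists b, ubound A b.
Proof.
move=> /pfcard_geP[->|[f]]; first by exists (\pi_omega1 OZero).
exists (\pi_omega1 (OSup (fun n => repr (f n)))) => a Aa.
have [n _ <-] := 'surj_f Aa; apply/ltW/omega1_ltP.
apply: onote_lt_le_trans (repr_piK _).2.
by exists n; exact: onote_le_refl.
Qed.

Lemma omega1_has_min (A : set omega1) : A !=set0 -> exists a, A a /\ lbound A a.
Proof.
move=> [a]; elim/(well_founded_ind omega1_wf): a => a IH Aa.
have [[b Ab ba]|nb] := pselect (exists2 b, A b & (b < a)%O); first exact: IH ba Ab.
exists a; split=> // b Ab; rewrite leNgt; apply/negP => ba.
by apply: nb; exists b.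
Qed.

(* The least element of [A]; junk when [A] is empty. *)
Definition ord_min (A : set omega1) : omega1 :=
  xget (\pi_omega1 OZero) [set a | A a /\ lbound A a].

Definition ord_zero : omega1 := ord_min setT.
Definition ord_succ a : omega1 := ord_min [set b | (a < b)%O].
(* A least upper bound exists when [A] is countable. *)
Definition ord_sup (A : set omega1) : omega1 := ord_min (ubound A).
Definition ord_one : omega1 := ord_succ ord_zero.
Definition ord_omega : omega1 := ord_sup [set iter n ord_succ ord_zero | n in setT].

Lemma ord_minP (A : set omega1) :
  A !=set0 -> A (ord_min A) /\ lbound A (ord_min A).
Proof.
by move=> /omega1_has_min; exact: (@xgetPex _ _ [set a | A a /\ lbound A a]).
Qed.

Lemma ord0_le a : (ord_zero <= a)%O.
Proof. by have [|_] := @ord_minP setT; [exists a|exact]. Qed.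

Lemma ord_succP a : (a < ord_succ a)%O /\ forall b, (a < b)%O -> (ord_succ a <= b)%O.
Proof.
apply: (@ord_minP [set b | (a < b)%O]).
exists (\pi_omega1 (OSup (fun=> repr a))); apply/omega1_ltP.
apply: onote_lt_le_trans (repr_piK _).2.
by exists 0%N; exact: onote_le_refl.
Qed.

Lemma ord_succ_inj : injective ord_succ.
Proof.
have le a b : ord_succ a = ord_succ b -> (a <= b)%O.
  move=> ab; rewrite leNgt; apply/negP => ba.
  by have := (ord_succP b).2 _ ba; rewrite -ab leNgt (ord_succP a).1.
by move=> a b ab; apply/le_anti; rewrite !le.
Qed.

Lemma ord_supP (A : set omega1) : countable A ->
  ubound A (ord_sup A) /\ forall b, ubound A b -> (ord_sup A <= b)%O.
Proof. by move=> /omega1_bounded Ab; exact: ord_minP. Qed.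

Definition ord_limit a : Prop := a <> ord_zero /\ forall b, a <> ord_succ b.

(* Definition by transfinite recursion: [z] is the value at 0, [s] gives the
   value at a successor from the value at its predecessor, and [l] gives the
   value at a limit from the set of all the previous values. *)
Definition ord_rec_step (T : Type) (z : T) (s : T -> T) (l : set T -> T)
    a (rec : forall b, (b < a)%O -> T) : T :=
  if pselect (a = ord_zero) then z else
  match pselect (exists b, a = ord_succ b) with
  | left e => s (rec (sval (cid e))
      (eq_ind_r (fun c => (sval (cid e) < c)%O)
         (ord_succP (sval (cid e))).1 (svalP (cid e))))
  | right _ => l [set t | exists b (ba : (b < a)%O), t = rec b ba]
  end.

Definition ord_rec (T : Type) (z : T) (s : T -> T) (l : set T -> T) :
    omega1 -> T :=
  Fix omega1_wf (fun=> T) (@ord_rec_step T z s l).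

Section ord_rec_theory.
Variables (T : Type) (z : T) (s : T -> T) (l : set T -> T).

Lemma ord_recE a :
  ord_rec z s l a = @ord_rec_step T z s l a (fun b _ => ord_rec z s l b).
Proof.
apply: (@Fix_eq _ _ omega1_wf (fun=> T)) => {}a f g fg; congr ord_rec_step.
by apply: functional_extensionality_dep => b;
   apply: functional_extensionality_dep => ba.
Qed.

Lemma ord_rec0 : ord_rec z s l ord_zero = z.
Proof. by rewrite ord_recE /ord_rec_step; case: pselect. Qed.

Lemma ord_recS a : ord_rec z s l (ord_succ a) = s (ord_rec z s l a).
Proof.
rewrite ord_recE /ord_rec_step; case: (pselect (_ = ord_zero)) => [a0|/= _].
  by exfalso; have := (ord_succP a).1; rewrite a0 ltNge ord0_le.
case: (pselect (exists b, _)) => /= [e|[]]; last by exists a.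
by congr (s (ord_rec z s l _)); rewrite -(ord_succ_inj (svalP (cid e))).
Qed.

Lemma ord_rec_lim a : ord_limit a ->
  ord_rec z s l a = l [set ord_rec z s l b | b in [set b | (b < a)%O]].
Proof.
move=> [a0 aS]; rewrite ord_recE /ord_rec_step; case: (pselect (a = ord_zero)) => //= _.
case: (pselect (exists b, _)) => [[b /aS//]|/= _]; congr l; apply/seteqP; split=> t /=.
  by move=> [b [ba ->]]; exists b.
by move=> [b ba <-]; exists b, ba.
Qed.

End ord_rec_theory.

Definition ord_add a : omega1 -> omega1 := ord_rec a ord_succ ord_sup.
Definition ord_mul a : omega1 -> omega1 :=
  ord_rec ord_zero (fun c => ord_add c a) ord_sup.
Definition ord_exp a : omega1 -> omega1 :=
  ord_rec ord_one (fun c => ord_mul c a) ord_sup.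

End ordinals.

Definition ord_itv1 (a : omega1) : Type := {b : omega1 | (ord_one <= b <= a)%O}.
HB.instance Definition _ a := SubChoice.on (ord_itv1 a).
HB.instance Definition _ a :=
  [SubChoice_isSubOrder of ord_itv1 a by <: with omega1_display].

Definition itv1_omega_exp (alpha : omega1) : topologicalType :=
  order_topology (ord_itv1 (ord_exp ord_omega alpha)).

(* A cardinal number is represented by any type of that cardinality;
   [is_card_sup P kappa] states that |kappa| is the supremum of the cardinals
   |G| for the types [G] satisfying [P]. *)
Definition is_card_sup (P : Type -> Prop) (kappa : Type) : Prop :=
  (forall G, P G -> [set: G] #<= [set: kappa]) /\
  forall D : Type, (forall G, P G -> [set: G] #<= [set: D]) ->
    [set: kappa] #<= [set: D].

(* The library's [zero_dimensional] only asks that clopen sets separate points. *)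
Definition zero_dim (S : topologicalType) : Prop :=
  exists2 B : set (set S), B `<=` clopen & basis B.

(* The accumulation points of A as a space on its own, hence the [A `&`]. *)
Definition accumulation (S : topologicalType) (A : set S) : set S :=
  A `&` limit_point A.

Definition CB_derivative (S : topologicalType) (alpha : omega1) : set S :=
  ord_rec [set: S] (@accumulation S) (fun F => \bigcap_(A in F) A) alpha.

Arguments CB_derivative S alpha : clear implicits.

Definition cellular_family (S : topologicalType) (U : set (set S)) : Prop :=
  (forall V, U V -> open V /\ V !=set0) /\ trivIset U id.

Definition is_relative_cellularity (S : topologicalType) (A : set S) :
    Type -> Prop :=
  is_card_sup (fun G => exists U : set (set S),
    [/\ cellular_family U, forall V, U V -> A `&` V !=set0 & [set: G] #= U]).

(* [{classic G}] is [G] itself, with the choice structure index types need. *)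
Definition copies (G : Type) (L : topologicalType) : topologicalType :=
  {_ : {classic G} & L}.
Definition K_copies (G : Type) (L : topologicalType) : topologicalType :=
  if pselect (finite_set [set: G]) then copies G L
  else one_point_compactification (copies G L).

Definition contfun (R : realType) (K : topologicalType) : Type :=
  continuousType K R.
HB.instance Definition _ (R : realType) (K : topologicalType) :=
  Choice.on (contfun R K).

Section contfun.
Variables (R : realType) (K : topologicalType).
Implicit Types (a b : R) (f g h : contfun R K).

Definition pack_contfun (f : K -> R) (fc : continuous f) : contfun R K :=
  mkcts fc.

Lemma contfunP f g : (forall x, f x = g x) <-> f = g.
Proof. by split=> [fg|->//]; apply/continuousEP. Qed.

Lemma contfun0_subproof : continuous (fun _ : K => 0 : R).
Proof. by move=> x; exact: cvg_cst. Qed.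
Lemma contfun1_subproof : continuous (fun _ : K => 1 : R).
Proof. by move=> x; exact: cvg_cst. Qed.
Lemma contfun_opp_subproof f : continuous (fun x => - f x).
Proof. by move=> x; apply: cvgN; exact: cts_fun. Qed.
Lemma contfun_add_subproof f g : continuous (fun x => f x + g x).
Proof. by move=> x; apply: cvgD; exact: cts_fun. Qed.
Lemma contfun_mul_subproof f g : continuous (fun x => f x * g x).
Proof. by move=> x; apply: cvgM; exact: cts_fun. Qed.
Lemma contfun_scale_subproof a f : continuous (fun x => a * f x).
Proof. by move=> x; apply: cvgM; [exact: cvg_cst|exact: cts_fun]. Qed.
Lemma contfun_max_subproof f g : continuous (fun x => Num.max (f x) (g x)).
Proof. by apply: max_fun_continuous; exact: cts_fun. Qed.
Lemma contfun_min_subproof f g : continuous (fun x => Num.min (f x) (g x)).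
Proof. by apply: min_fun_continuous; exact: cts_fun. Qed.

Definition contfun0 := pack_contfun contfun0_subproof.
Definition contfun1 := pack_contfun contfun1_subproof.
Definition contfun_opp f := pack_contfun (@contfun_opp_subproof f).
Definition contfun_add f g := pack_contfun (@contfun_add_subproof f g).
Definition contfun_mul f g := pack_contfun (@contfun_mul_subproof f g).
Definition contfun_scale a f := pack_contfun (@contfun_scale_subproof a f).
Definition contfun_max f g := pack_contfun (@contfun_max_subproof f g).
Definition contfun_min f g := pack_contfun (@contfun_min_subproof f g).

Fact contfun_addA : associative contfun_add.
Proof. by move=> f g h; apply/contfunP => x; exact: addrA. Qed.
Fact contfun_addC : commutative contfun_add.
Proof. by move=> f g; apply/contfunP => x; exact: addrC. Qed.
Fact contfun_add0 : left_id contfun0 contfun_add.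
Proof. by move=> f; apply/contfunP => x; exact: add0r. Qed.
Fact contfun_addN : left_inverse contfun0 contfun_opp contfun_add.
Proof. by move=> f; apply/contfunP => x; exact: addNr. Qed.
HB.instance Definition _ := GRing.isZmodule.Build (contfun R K)
  contfun_addA contfun_addC contfun_add0 contfun_addN.

Fact contfun_mulA : associative contfun_mul.
Proof. by move=> f g h; apply/contfunP => x; exact: mulrA. Qed.
Fact contfun_mulC : commutative contfun_mul.
Proof. by move=> f g; apply/contfunP => x; exact: mulrC. Qed.
Fact contfun_mul1 : left_id contfun1 contfun_mul.
Proof. by move=> f; apply/contfunP => x; exact: mul1r. Qed.
Fact contfun_mulDl : left_distributive contfun_mul contfun_add.
Proof. by move=> f g h; apply/contfunP => x; exact: mulrDl. Qed.
HB.instance Definition _ := GRing.Zmodule_isComPzRing.Build (contfun R K)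
  contfun_mulA contfun_mulC contfun_mul1 contfun_mulDl.

Fact contfun_scaleA a b f :
  contfun_scale a (contfun_scale b f) = contfun_scale (a * b) f.
Proof. by apply/contfunP => x; exact: mulrA. Qed.
Fact contfun_scale1 : left_id 1 contfun_scale.
Proof. by move=> f; apply/contfunP => x; exact: mul1r. Qed.
Fact contfun_scaleDr : right_distributive contfun_scale +%R.
Proof. by move=> a f g; apply/contfunP => x; exact: mulrDr. Qed.
Fact contfun_scaleDl f : {morph contfun_scale^~ f : a b / a + b}.
Proof. by move=> a b; apply/contfunP => x; exact: mulrDl. Qed.
HB.instance Definition _ := GRing.Zmodule_isLmodule.Build R (contfun R K)
  contfun_scaleA contfun_scale1 contfun_scaleDr contfun_scaleDl.

(* Meaningful when K is compact and nonempty, the set below being then bounded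
   and nonempty. *)
Definition sup_norm f : R := sup [set `|f x| | x in [set: K]].

End contfun.

Section embeddings.
Variables (R : realType) (L K : topologicalType).
Implicit Types T : {linear contfun R L -> contfun R K}.

Definition isometric T : Prop := forall f, sup_norm (T f) = sup_norm f.

Definition positive_map T : Prop :=
  forall f : contfun R L, (forall x, 0 <= f x) -> forall y, 0 <= T f y.

Definition lattice_map T : Prop := forall f g,
  T (contfun_max f g) = contfun_max (T f) (T g) /\
  T (contfun_min f g) = contfun_min (T f) (T g).

(* The unit need not be preserved. *)
Definition multiplicative_map T : Prop := forall f g, T (f * g) = T f * T g.

Definition embeds_isometrically : Prop := exists T, isometric T.

Definition embeds_positively_isometrically : Prop :=
  exists T, isometric T /\ positive_map T.

Definition embeds_lattice_algebraically_isometrically : Prop :=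
  exists T, [/\ isometric T, lattice_map T & multiplicative_map T].

End embeddings.

Definition maps_continuously_onto (K L : topologicalType) : Prop :=
  exists f : K -> L, continuous f /\ forall y, exists x, f x = y.

(* Main.v *)
(* The points of [1, omega^a] organise it as a tree of clopen blocks: a block of
   rank a is a last point p together with disjoint blocks of ranks e n < a,
   cofinal in a, which converge to p.  The same nonempty index sets G
   occur in (1)-(5), which follows from three constructions.

   If T is an isometric embedding into C(K), then by induction on blocks the
   last point p of a block of rank a admits a y in K^(a) with |T f y| = |f p|
   for all f: for an isolated p this is a norm computation with the indicator of
   p, and otherwise y is a cluster point of the points found for the smaller
   blocks.  The sets {|T 1_g| > 1/2}, where 1_g is the indicator of the g-th copy
   of [1, omega^a], then form a cellular family meeting K^(a).

   Conversely, x in K^(a) is a limit of points of the K^(e n), so disjoint open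
   sets W n converge around x as the smaller blocks do around p.  Given positive
   operators T n from C(M) to functions supported in W n, one for each smaller
   block, f |-> f(p) phi + sum_n T n (f - f(p)), with phi a bump equal to 1 on
   the W n, handles the whole block.  The same formula with phi = 1 combines the
   copies of [1, omega^a] attached to the sets of a cellular family.

   When K is zero-dimensional the W n can be taken clopen, and continuous maps
   of W n onto the smaller blocks are glued by sending everything else to p;
   composition with a continuous surjection is a lattice and algebra isometry. *)

Require Import Defs.
From HB Require Import structures.
From mathcomp Require Import all_boot all_order all_algebra.
From mathcomp Require Import all_classical all_reals all_analysis.
From mathcomp Require Import ring lra.
Import Order.TTheory GRing.Theory Num.Theory.
Import numFieldNormedType.Exports.

Set Implicit Arguments.
Unset Strict Implicit.
Unset Printing Implicit Defensive.

Local Open Scope classical_set_scope.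

(** * Suprema of cardinals *)

Section cardinal_suprema.
Local Open Scope card_scope.

(* Zorn's lemma gives a maximal set of choice functions on which all the
   projections are injective; by maximality one of them is onto. *)
Lemma exists_card_min (I X : Type) (D : I -> set X) (i0 : I) :
  exists i, forall j, D i #<= D j.
Proof.
pose P : set (set (I -> X)) := [set A |
  (forall a, A a -> forall i, D i (a i)) /\
  forall i a b, A a -> A b -> a i = b i -> a = b].
have [|A [[AD Ainj] Amax]] := @Zorn_bigcup _ P.
  move=> F FP Ftot; split=> [a [A FA Aa] i|i a b [A FA Aa] [B FB Bb]].
    exact: (FP _ FA).1 _ Aa i.
  have [AB|BA] := Ftot _ _ FA FB.
    exact: (FP _ FB).2 i a b (AB _ Aa) Bb.
  exact: (FP _ FA).2 i a b Aa (BA _ Bb).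
have [[i Di]|none] := pselect (exists i, forall x, D i x -> exists2 a, A a & a i = x).
  exists i => j; apply: (@card_le_trans _ _ _ A).
    apply: card_le_trans (card_image_le (fun a : I -> X => a i) A).
    by apply: subset_card_le => x /Di[a Aa <-]; exists a.
  apply: (@card_le_trans _ _ _ ((fun a : I -> X => a j) @` A)).
    have : (fun a : I -> X => a j) @` A #= A.
      by apply: inj_card_eq => a b /set_mem Aa /set_mem Ab; exact: Ainj.
    by rewrite card_eq_le => /andP[].
  by apply: subset_card_le => x [a Aa <-]; exact: AD.
exfalso.
have /choice[c cP] : forall i, exists x, D i x /\ forall a, A a -> a i <> x.
  move=> i; apply: contrapT => nx; apply: none; exists i => x Dx.
  apply: contrapT => na; apply: nx; exists x; split=> // a Aa ax.
  by apply: na; exists a.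
apply: (Amax (A `|` [set c])).
  split; first by move=> a Aa; left.
  by move=> /(_ c (or_intror erefl)) /(cP i0).2.
split=> [a [/AD//|-> i]|i a b [Aa|->] [Ab|->]]; first exact: (cP i).1.
- exact: Ainj.
- by move=> /((cP i).2 _ Aa).
- by move=> /esym/((cP i).2 _ Ab).
- by [].
Qed.

(** Comparability is the two-member case of [exists_card_min]; the disjoint sum provides a common
    ambient type for the two sets. *)
Lemma card_le_or (X Y : Type) :
  [set: X] #<= [set: Y] \/ [set: Y] #<= [set: X].
Proof.
pose D (b : bool) : set (X + Y) := if b then range inl else range inr.
have Dl : D true #= [set: X] by apply: inj_card_eq => x y _ _ [].
have Dr : D false #= [set: Y] by apply: inj_card_eq => x y _ _ [].
have [[] Di] := exists_card_min D true.
  by left; rewrite -(card_le_eql Dl) -(card_le_eqr Dr).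
by right; rewrite -(card_le_eql Dr) -(card_le_eqr Dl).
Qed.

(** The supremum is a subset of [X] of least cardinality among those that are upper bounds. It is
    minimal among all types, since a bound [E] either dominates [X] or is equinumerous with a subset
    of [X]. *)
Lemma is_card_sup_exists (P : Type -> Prop) (X : Type) :
  (forall G, P G -> [set: G] #<= [set: X]) -> exists kappa, is_card_sup P kappa.
Proof.
move=> PX.
pose ubs := {D : set X | forall G, P G -> [set: G] #<= D}.
have [[D PD] /= Dmin] := exists_card_min (fun i : ubs => sval i) (exist _ [set: X] PX).
exists {x | D x}.
have DD : [set: {x | D x}] #= D.
  have DE : range (@sval _ D) = D.
    by apply/seteqP; split=> [_ [[x Dx] _ <-]//|x Dx]; exists (exist _ x Dx).
  rewrite card_eq_sym; suff : range (@sval _ D) #= [set: {x | D x}] by rewrite DE.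
  by apply: inj_card_eq => -[x Dx] [y Dy] _ _ /= xy; exact: eq_exist.
split=> [G PG|E PE]; first by rewrite (card_le_eqr DD); exact: PD.
rewrite (card_le_eql DD).
have [XE|EX] := card_le_or X E; first exact: card_le_trans (card_leT D) XE.
have /card_leP[f] := EX.
pose g (e : E) : X := \val (f (SigSub (mem_set (I : [set: E] e)))).
have gE : range g #= [set: E].
  apply: inj_card_eq => e e' _ _ /val_inj /inj => /(_ (in_setT _) (in_setT _)).
  by case.
have PgE G : P G -> [set: G] #<= range g by move=> /PE; rewrite (card_le_eqr gE).
by have := Dmin (exist _ (range g) PgE); rewrite /= (card_le_eqr gE).
Qed.

(** An empty index type has cardinality 0 and cannot affect a supremum. This reconciles cellular
    families, which may be empty, with the nonempty index sets of the other suprema. *)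
Lemma is_card_sup_inhabited (P Q : Type -> Prop) (kappa : Type) :
  (forall G, inhabited G -> P G <-> Q G) ->
  is_card_sup P kappa -> is_card_sup (fun G => inhabited G /\ Q G) kappa.
Proof.
move=> PQ [Pk kmin]; split=> [G [iG /(PQ _ iG)/Pk]//|D QD]; apply: kmin => G PG.
have [iG|nG] := pselect (inhabited G); first by apply: QD; split=> //; exact/PQ.
suff -> : [set: G] = set0 by exact: card_ge0.
by apply/seteqP; split=> // g _; case: nG; exists.
Qed.

End cardinal_suprema.

(** * Ordinal arithmetic *)

Section ordinal_arithmetic.
Local Open Scope order_scope.
Implicit Types a b c d g x y : omega1.

Lemma ord_eq_lt a b : (forall x, (x < a) <-> (x < b)) -> a = b.
Proof.
move=> ab; apply/le_anti; rewrite !leNgt; apply/andP; split; apply/negP.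
  by move=> /ab; rewrite ltxx.
by move=> /(ab _).2; rewrite ltxx.
Qed.

Lemma ord_ltS a b : (b < ord_succ a) = (b <= a).
Proof.
have [asa sa] := ord_succP a; apply/idP/idP => [bsa|/le_lt_trans]; last exact.
by rewrite leNgt; apply/negP => /sa; rewrite leNgt bsa.
Qed.

Lemma ord_lt0 a : (a < ord_zero) = false.
Proof. by rewrite ltNge ord0_le. Qed.

Lemma ord_cases a : a = ord_zero \/ (exists b, a = ord_succ b) \/ ord_limit a.
Proof.
have [->|a0] := pselect (a = ord_zero); first by left.
have [|aS] := pselect (exists b, a = ord_succ b); first by right; left.
by right; right; split=> // b ab; apply: aS; exists b.
Qed.

Lemma ord_limit_gt0 a : ord_limit a -> ord_zero < a.
Proof. by move=> [a0 _]; rewrite lt_neqAle ord0_le andbT; apply/eqP => /esym. Qed.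

Lemma ord_limitS a b : ord_limit a -> b < a -> ord_succ b < a.
Proof.
move=> [_ aS] ba; rewrite lt_neqAle (ord_succP b).2// andbT.
by apply/eqP => /esym; exact: aS.
Qed.

Lemma ord_sup_lt (A : set omega1) x : countable A ->
  x < ord_sup A <-> exists2 a, A a & x < a.
Proof.
move=> /ord_supP[ubA lubA]; split=> [xA|[a Aa xa]]; last exact: lt_le_trans (ubA _ Aa).
apply: contrapT => nA; move: xA; rewrite ltNge lubA// => a Aa.
by rewrite leNgt; apply/negP => xa; apply: nA; exists a.
Qed.

Lemma ord_rec_lim_lt (z : omega1) (s : omega1 -> omega1) a x : ord_limit a ->
  x < ord_rec z s ord_sup a <-> exists2 b, b < a & x < ord_rec z s ord_sup b.
Proof.
move=> la; rewrite ord_rec_lim// ord_sup_lt; last first.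
  exact: card_le_trans (card_image_le _ _) (omega1_countable_segment a).
split=> [[_ [b ba <-] xb]|[b ba xb]]; first by exists b.
by exists (ord_rec z s ord_sup b) => //; exists b.
Qed.

Lemma ord_addS g d : ord_add g (ord_succ d) = ord_succ (ord_add g d).
Proof. exact: ord_recS. Qed.

Lemma ord_add0 g : ord_add g ord_zero = g.
Proof. exact: ord_rec0. Qed.

(** The predecessors of g + d are those of g followed by a copy of those of d. Associativity and
    monotonicity are derived from this description rather than from the recursion. *)
Lemma ord_add_ltP g d x :
  x < ord_add g d <-> x < g \/ exists2 d', d' < d & x = ord_add g d'.
Proof.
elim/(well_founded_ind omega1_wf): d x => d IH x.
have [->|[[b db]|ld]] := ord_cases d.
- rewrite ord_add0; split=> [|[//|[d']]]; first by left.
  by rewrite ord_lt0.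
- have bd : b < d by rewrite db ord_ltS.
  rewrite {1}db ord_addS ord_ltS le_eqVlt; split=> [/predU1P[->|/(IH _ bd)]|].
  + by right; exists b.
  + by move=> [|[d' d'b ->]]; [left|right; exists d' => //; exact: lt_trans bd].
  + move=> [xg|[d']]; first by apply/orP; right; apply/(IH _ bd); left.
    rewrite db ord_ltS le_eqVlt => /predU1P[-> ->|d'b ->]; first by rewrite eqxx.
    by apply/orP; right; apply/(IH _ bd); right; exists d'.
- rewrite ord_rec_lim_lt//; split=> [[b bd /(IH _ bd)]|].
    by move=> [|[d' d'b ->]]; [left|right; exists d' => //; exact: lt_trans bd].
  move=> [xg|[d' d'd ->]].
    by exists ord_zero; [exact: ord_limit_gt0|rewrite -/(ord_add _ _) ord_add0].
  exists (ord_succ d'); first exact: ord_limitS.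
  by rewrite -!/(ord_add _ _) ord_addS ord_ltS.
Qed.

Lemma ord_add_lt g d d' : d' < d -> ord_add g d' < ord_add g d.
Proof. by move=> d'd; apply/ord_add_ltP; right; exists d'. Qed.

Lemma ord_add_le g d d' : d' <= d -> ord_add g d' <= ord_add g d.
Proof. by rewrite le_eqVlt => /predU1P[->//|/(ord_add_lt g)/ltW]. Qed.

Lemma ord_le_add g d : g <= ord_add g d.
Proof. by rewrite -[leLHS](ord_add0 g); apply: ord_add_le; exact: ord0_le. Qed.

Lemma ord_addA g a b : ord_add g (ord_add a b) = ord_add (ord_add g a) b.
Proof.
elim/(well_founded_ind omega1_wf): b => b IH.
apply: ord_eq_lt => x; split=> /ord_add_ltP.
- move=> [xg|[e /ord_add_ltP[ea|[b' b'b ->]] ->]].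
  + exact: lt_le_trans xg (le_trans (ord_le_add _ _) (ord_le_add _ _)).
  + exact: lt_le_trans (ord_add_lt g ea) (ord_le_add _ _).
  + by rewrite IH//; exact: ord_add_lt.
- move=> [xga|[b' b'b ->]].
    by apply: lt_le_trans xga _; apply: ord_add_le; exact: ord_le_add.
  by rewrite -IH//; apply: ord_add_lt; exact: ord_add_lt.
Qed.

Lemma ord_add0l a : ord_add ord_zero a = a.
Proof.
elim/(well_founded_ind omega1_wf): a => a IH; apply: ord_eq_lt => x.
rewrite ord_add_ltP ord_lt0; split=> [[//|[d da ->]]|xa]; first by rewrite IH.
by right; exists x; rewrite ?IH.
Qed.

Lemma ord_add_le2r a b d : a <= b -> ord_add a d <= ord_add b d.
Proof.
move=> ab; elim/(well_founded_ind omega1_wf): d => d IH.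
rewrite leNgt; apply/negP => /ord_add_ltP[|[d' d'd bd]].
  by move=> /lt_le_trans/(_ (le_trans ab (ord_le_add b d))); rewrite ltxx.
by have := le_lt_trans (IH _ d'd) (ord_add_lt b d'd); rewrite -bd ltxx.
Qed.

Definition ord_nat n : omega1 := iter n ord_succ ord_zero.

Lemma ord_lt_omega x : x < ord_omega <-> exists n, x = ord_nat n.
Proof.
have natS n : ord_nat n < ord_nat n.+1 by rewrite ord_ltS.
rewrite ord_sup_lt; last exact: card_le_trans (card_image_le _ _) (card_lexx _).
split=> [[_ [n _ <-]]|[n ->]]; last by exists (ord_nat n.+1) => //; exists n.+1.
elim: n => [|n IH]; first by rewrite ord_lt0.
by rewrite ord_ltS le_eqVlt => /predU1P[->|/IH//]; exists n.
Qed.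

Lemma ord_omega_limit : ord_limit ord_omega.
Proof.
split=> [w0|b wS].
  by have := (ord_lt_omega ord_zero).2 (ex_intro _ 0%N erefl); rewrite w0 ltxx.
have /ord_lt_omega[n bn] : b < ord_omega by rewrite wS ord_ltS.
have := (ord_lt_omega (ord_succ b)).2 (ex_intro _ n.+1 (congr1 ord_succ bn)).
by rewrite wS ltxx.
Qed.

Lemma ord_mul_omega_lt a x :
  x < ord_mul a ord_omega <-> exists n, x < iter n (ord_add^~ a) ord_zero.
Proof.
have mulE n : ord_mul a (ord_nat n) = iter n (ord_add^~ a) ord_zero.
  elim: n => [|n IH]; first exact: ord_rec0.
  by rewrite /ord_mul /ord_nat iterS ord_recS -/(ord_mul _ _) -/(ord_nat _) IH.
rewrite ord_rec_lim_lt; last exact: ord_omega_limit.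
split=> [[_ /ord_lt_omega[n ->] xn]|[n]].
  by exists n; rewrite -mulE.
by rewrite -mulE; exists (ord_nat n) => //; apply/ord_lt_omega; exists n.
Qed.

Local Notation opow := (ord_exp ord_omega).
Local Notation omuln b n := (iter n (ord_add^~ (opow b)) ord_zero).

Lemma opow0 : opow ord_zero = ord_succ ord_zero.
Proof. exact: ord_rec0. Qed.

Lemma opowS_lt b x : x < opow (ord_succ b) <-> exists n, x < omuln b n.
Proof. by rewrite -ord_mul_omega_lt /ord_exp ord_recS. Qed.

Lemma opow_lim_lt a x : ord_limit a ->
  x < opow a <-> exists2 b, b < a & x < opow b.
Proof. exact: ord_rec_lim_lt. Qed.

Lemma opow_gt0 a : ord_zero < opow a.
Proof.
elim/(well_founded_ind omega1_wf): a => a IH.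
have [->|[[b ab]|la]] := ord_cases a.
- by rewrite opow0 ord_ltS.
- rewrite ab opowS_lt; exists 1%N; rewrite /= ord_add0l.
  by apply: IH; rewrite ab ord_ltS.
- apply/opow_lim_lt => //; exists ord_zero; first exact: ord_limit_gt0.
  by apply: IH; exact: ord_limit_gt0.
Qed.

Lemma opow_ltS b : opow b < opow (ord_succ b).
Proof.
apply/opowS_lt; exists 2%N; rewrite /= ord_add0l -[ltLHS]ord_add0.
exact/ord_add_lt/opow_gt0.
Qed.

Lemma opow_lt b a : b < a -> opow b < opow a.
Proof.
elim/(well_founded_ind omega1_wf): a => a IH ba.
have [a0|[[c ac]|la]] := ord_cases a.
- by move: ba; rewrite a0 ord_lt0.
- move: ba; rewrite ac ord_ltS le_eqVlt => /predU1P[->|bc]; first exact: opow_ltS.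
  by apply: lt_trans (opow_ltS c); apply: IH => //; rewrite ac ord_ltS.
- apply/opow_lim_lt => //; exists (ord_succ b); first exact: ord_limitS.
  exact: opow_ltS.
Qed.

Lemma opow_le b a : b <= a -> opow b <= opow a.
Proof. by rewrite le_eqVlt => /predU1P[->//|/opow_lt/ltW]. Qed.

Lemma omuln_add b n m : ord_add (omuln b n) (omuln b m) = omuln b (m + n).
Proof. by elim: m => [|m IH]; rewrite ?ord_add0// addSn !iterS -IH ord_addA. Qed.

(** Powers of omega are additively indecomposable: at a successor exponent both summands lie below
    finite multiples of the preceding power, and at a limit both lie below one earlier power. *)
Lemma opow_add_lt a x y : x < opow a -> y < opow a -> ord_add x y < opow a.
Proof.
elim/(well_founded_ind omega1_wf): a => a IH in x y *.
have [->|[[b ->]|la]] := ord_cases a.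
- rewrite opow0 !ord_ltS => x0 y0.
  suff -> : y = ord_zero by rewrite ord_add0.
  by apply/le_anti; rewrite y0 ord0_le.
- move=> /opowS_lt[n xn] /opowS_lt[m ym]; apply/opowS_lt; exists (m + n)%N.
  rewrite -omuln_add; apply: le_lt_trans (ord_add_lt _ ym).
  exact/ord_add_le2r/ltW.
- move=> /opow_lim_lt-/(_ la)[b ba xb] /opow_lim_lt-/(_ la)[c ca yc].
  apply/opow_lim_lt => //; exists (Order.max b c); first by rewrite gt_max ba.
  apply: IH; first by rewrite gt_max ba.
    by apply: lt_le_trans xb _; apply: opow_le; rewrite le_max lexx.
  by apply: lt_le_trans yc _; apply: opow_le; rewrite le_max lexx orbT.
Qed.

(** The running maxima of an enumeration of the ordinals below [a] are nondecreasing, so that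
    cofinality becomes eventual domination. *)
Lemma ord_limit_cofinal a : ord_limit a ->
  exists e : nat -> omega1, (forall n, e n < a) /\
    forall b, b < a -> exists N, forall n, (N <= n)%N -> b <= e n.
Proof.
move=> la; have /pfcard_geP[a0|[e]] := omega1_countable_segment a.
  have : [set b | b < a] ord_zero by exact: ord_limit_gt0.
  by rewrite a0.
pose h := fix h n := if n is k.+1 then Order.max (h k) (e n) else e 0%N.
have ea n : e n < a by exact: 'funS_e.
have ha n : h n < a by elim: n => [|n IH] /=; rewrite ?gt_max ?IH ea.
have eh n : e n <= h n by case: n => [|n] //=; rewrite le_max lexx orbT.
have hle n m : (n <= m)%N -> h n <= h m.
  elim: m => [|m IH]; first by rewrite leqn0 => /eqP->.
  rewrite leq_eqVlt => /predU1P[->//|/IH nm].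
  by rewrite /= le_max nm.
exists h; split=> // b ba; have [k _ <-] := 'surj_e ba.
by exists k => n /hle; exact: le_trans (eh k).
Qed.

(** This writes omega^a as an infinite sum of smaller powers omega^(e n), with partial sums [s]. At
    a successor b + 1 the exponents are constantly b; at a limit they form a cofinal sequence, and
    indecomposability keeps the partial sums below omega^a. *)
Lemma opow_fundamental a : a <> ord_zero ->
  exists e s : nat -> omega1,
    [/\ s 0%N = ord_zero,
        forall n, s n.+1 = ord_add (s n) (opow (e n)),
        forall n, e n < a,
        forall b, b < a -> exists N, forall n, (N <= n)%N -> b <= e n &
        forall x, x < opow a <-> exists n, x < s n].
Proof.
move=> a0; have [//|[[b ab]|la]] := ord_cases a.
  exists (fun=> b), (fun n => omuln b n); split=> //.
  - by move=> _; rewrite ab ord_ltS.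
  - by move=> c; rewrite ab ord_ltS => cb; exists 0%N.
  - by move=> x; rewrite ab opowS_lt.
have [e [ea ecof]] := ord_limit_cofinal la.
pose s := fix s n := if n is k.+1 then ord_add (s k) (opow (e k)) else ord_zero.
have sa n : s n < opow a.
  elim: n => [|n IH] /=; first exact: opow_gt0.
  by apply: opow_add_lt => //; exact: opow_lt.
exists e, s; split=> // x; split=> [/opow_lim_lt-/(_ la)[b ba xb]|[n xn]].
  have [m /(_ m (leqnn m)) bm] := ecof _ ba; exists m.+1 => /=.
  apply: lt_le_trans xb (le_trans (opow_le bm) _).
  by rewrite -[leLHS]ord_add0l; apply: ord_add_le2r; exact: ord0_le.
exact: lt_trans (sa n).
Qed.

End ordinal_arithmetic.

(** * Blocks in ordinal intervals *)

(* The model is the interval ]g, g + omega^a] of ordinals, with last point p. *)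
Inductive block (M : topologicalType) : omega1 -> set M -> M -> Prop :=
| block_isolated p : clopen [set p] -> block ord_zero [set p] p
| block_cluster a p (e : nat -> omega1) (B : nat -> set M) (q : nat -> M) :
    (forall n, block (e n) (B n) (q n)) ->
    (forall n, clopen (B n)) ->
    (forall n, ~ B n p) ->
    trivIset setT B ->
    (forall V, nbhs p V -> exists N, forall n, (N <= n)%N -> B n `<=` V) ->
    (forall n, (e n < a)%O) ->
    (forall b, (b < a)%O -> exists N, forall n, (N <= n)%N -> (b <= e n)%O) ->
    block a ([set p] `|` \bigcup_n B n) p.

Lemma block_mem (M : topologicalType) a (B : set M) p : block a B p -> B p.
Proof. by case=> [//|? ? ? ? ? *]; left. Qed.

(** This transports the block structure of [1, omega^a] to each of its copies. *)
Lemma block_image (L M : topologicalType) (j : L -> M) a (B : set L) p :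
  injective j -> continuous j -> (forall D, clopen D -> clopen (j @` D)) ->
  block a B p -> block a (j @` B) (j p).
Proof.
move=> jinj jcont jclopen; elim=> {a B p} [p cp|a p e B q _ IH cB Bp tB Bcvg ea ecof].
  by have := jclopen _ cp; rewrite image_set1 => cjp; exact: block_isolated.
rewrite image_setU image_set1 image_bigcup; apply: block_cluster IH _ _ _ _ ea ecof.
- by move=> n; exact: jclopen.
- by move=> n [x Bx /jinj xp]; apply: (Bp n); rewrite -xp.
- apply/trivIsetP => m n _ _ mn; apply/seteqP; split=> // _ [[x Bx <-] [y By /jinj yx]].
  have /trivIsetP/(_ m n I I mn) Bmn := tB.
  have : (B m `&` B n) x by split=> //; rewrite -yx.
  by rewrite Bmn.
- move=> V /jcont/Bcvg[N BV]; exists N => n /BV{}BV _ [x /BV Vx <-].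
  exact: Vx.
Qed.

Section ordinal_interval.
Variable lam : omega1.
Local Notation L := (order_topology (ord_itv1 lam)).
Local Open Scope order_scope.
Local Open Scope classical_set_scope.
Implicit Types (x p : L) (c d : omega1).

Definition ord_val (x : L) : omega1 := \val (x : ord_itv1 lam).
Local Notation v := ord_val.

Lemma ord_val_ltE x p : (x < p) = (v x < v p).
Proof. exact: ltEsub. Qed.

Lemma ord_val_inj : injective (ord_val : L -> omega1).
Proof. exact: val_inj. Qed.

Lemma ord_valP x : ord_one <= v x <= lam.
Proof. exact: (valP (x : ord_itv1 lam)). Qed.

Lemma ord_val_ge1 x : ord_one <= v x. Proof. by have /andP[] := ord_valP x. Qed.
Lemma ord_val_le x : v x <= lam. Proof. by have /andP[] := ord_valP x. Qed.

Definition ord_point c (c1 : ord_one <= c) (cl : c <= lam) : L :=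
  Sub c (introT andP (conj c1 cl)).

Lemma ord_val_point c (c1 : ord_one <= c) (cl : c <= lam) :
  v (ord_point c1 cl) = c.
Proof. exact: SubK. Qed.

(** The bound is any countable ordinal, possibly outside the interval, where the ray is everything
    or nothing. The bound 0 does occur below. *)
Lemma open_ord_gt c : open [set x : L | c < ord_val x].
Proof.
have [c1|c1] := leP ord_one c; last first.
  suff -> : [set x : L | c < v x] = setT by exact: openT.
  by apply/seteqP; split=> // x _; exact: lt_le_trans c1 (ord_val_ge1 x).
have [cl|lc] := leP c lam; last first.
  suff -> : [set x : L | c < v x] = set0 by exact: open0.
  apply/seteqP; split=> // x /= cx.
  by have := lt_trans lc (lt_le_trans cx (ord_val_le x)); rewrite ltxx.
suff -> : [set x : L | c < v x] = `]ord_point c1 cl, +oo[%classic by exact: rray_open.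
by apply/seteqP; split=> x /=; rewrite in_itv/= andbT ord_val_ltE ord_val_point.
Qed.

Lemma open_ord_lt c : open [set x : L | ord_val x < c].
Proof.
have [c1|c1] := leP ord_one c; last first.
  suff -> : [set x : L | v x < c] = set0 by exact: open0.
  apply/seteqP; split=> // x /= xc.
  by have := lt_trans c1 (le_lt_trans (ord_val_ge1 x) xc); rewrite ltxx.
have [cl|lc] := leP c lam; last first.
  suff -> : [set x : L | v x < c] = setT by exact: openT.
  by apply/seteqP; split=> // x _; exact: le_lt_trans (ord_val_le x) lc.
suff -> : [set x : L | v x < c] = `]-oo, ord_point c1 cl[%classic by exact: lray_open.
by apply/seteqP; split=> x /=; rewrite in_itv/= ord_val_ltE ord_val_point.
Qed.

Definition ord_segment c d : set L :=
  [set x : L | c < ord_val x <= d].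

Lemma ord_segmentE c d x : ord_segment c d x = (c < ord_val x <= d).
Proof. by []. Qed.

(** Since x <= d means x < d + 1, both the segment and its complement are built from open rays. *)
Lemma clopen_ord_segment c d : clopen (ord_segment c d).
Proof.
split.
  have -> : ord_segment c d = [set x | c < v x] `&` [set x | v x < ord_succ d].
    apply/seteqP; split=> [x /andP[cx xd]|x [/= cx]]; first by split; rewrite //= ord_ltS.
    by rewrite ord_ltS => xd; apply/andP.
  by apply: openI; [exact: open_ord_gt|exact: open_ord_lt].
have -> : ord_segment c d = ~` ([set x | v x < ord_succ c] `|` [set x | d < v x]).
  apply/seteqP; split=> [x /andP[cx xd] [/=|/=]|x /not_orP[/= xc dx]].
  - by rewrite ord_ltS leNgt cx.
  - by rewrite ltNge xd.
  - by move: xc dx; rewrite ord_ltS => /negP + /negP; rewrite -ltNge -leNgt ord_segmentE => -> ->.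
by apply: open_closedC; apply: openU; [exact: open_ord_lt|exact: open_ord_gt].
Qed.

(** An open interval around p contains all points between its left end and p; when it is unbounded
    to the left, 0 serves as left end, being below every point. *)
Lemma nbhs_ord_segment p (V : set L) : nbhs p V ->
  exists2 c, c < ord_val p & ord_segment c (ord_val p) `<=` V.
Proof.
rewrite itv_nbhsE => -[i [oi pi] iV].
have v_gt0 x : ord_zero < v x by apply: lt_le_trans (ord_val_ge1 x); rewrite ord_ltS.
case: i oi pi iV => -[[]l|[]] [[]r|[]]// _; rewrite in_itv/= ?andbT.
- move=> /andP[lp pr] lV; exists (v l); first by rewrite -ord_val_ltE.
  move=> x /andP[lx xp]; apply: lV; rewrite /= in_itv/= !ord_val_ltE lx/=.
  by apply: le_lt_trans xp _; rewrite -ord_val_ltE.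
- move=> lp lV; exists (v l); first by rewrite -ord_val_ltE.
  by move=> x /andP[lx xp]; apply: lV; rewrite /= in_itv/= !ord_val_ltE lx.
- move=> pr lV; exists ord_zero => // x /andP[_ xp]; apply: lV.
  by rewrite /= in_itv/= ord_val_ltE; apply: le_lt_trans xp _; rewrite -ord_val_ltE.
- by move=> _ lV; exists ord_zero => // x _; exact: lV.
Qed.

(** An ultrafilter converges to the least b such that the points up to b form one of its members:
    for c < b it then contains the segment ]c, b]. *)
Lemma compact_ord_itv1 : compact [set: L].
Proof.
rewrite compact_ultra => F FU _; have FP := @ultra_proper _ _ FU.
pose A := [set b | F [set x : L | v x <= b]].
have [b [Ab bA]] : exists b, A b /\ lbound A b.
  apply: omega1_has_min; exists lam; apply: filterS (@filterT _ F _) => x _.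
  exact: ord_val_le.
have [x0 /= x0b] := filter_ex Ab.
have b1 : ord_one <= b by exact: le_trans (ord_val_ge1 x0) x0b.
have bl : b <= lam.
  apply: bA; apply: filterS (@filterT _ F _) => x _; exact: ord_val_le.
exists (ord_point b1 bl); split=> // V /nbhs_ord_segment; rewrite ord_val_point => -[c cb cV].
have nc : ~ F [set x : L | v x <= c].
  by move=> Fc; have := bA _ Fc; rewrite leNgt cb.
have [//|Fc] := in_ultra_setVsetC [set x : L | v x <= c] FU.
apply: filterS (filterI Ab Fc) => x [/= xb /negP]; rewrite -ltNge => cx.
by apply: cV; apply/andP.
Qed.

Local Notation opow := (ord_exp ord_omega).

(** The partial sums of [opow_fundamental], shifted by [g], cut the interval into consecutive
    segments of lengths omega^(e n), to which the induction hypothesis applies; these segments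
    converge to the last point. *)
Lemma block_ord_segment a g p : ord_val p = ord_add g (opow a) ->
  block a (ord_segment g (ord_add g (opow a))) p.
Proof.
elim/(well_founded_ind omega1_wf): a g p => a IH g p pE.
have [a0|a0] := pselect (a = ord_zero).
  have Ep : ord_segment g (ord_add g (opow a)) = [set p].
    rewrite -pE; apply/seteqP; split=> [x|_ ->]; last first.
      by rewrite ord_segmentE lexx andbT pE -[ltLHS]ord_add0 ord_add_lt// opow_gt0.
    move=> /andP[gx xp]; apply: ord_val_inj; apply/le_anti.
    by rewrite xp pE a0 opow0 ord_addS ord_add0 (ord_succP g).2.
  have cp := clopen_ord_segment g (ord_add g (opow a)).
  by rewrite Ep in cp *; rewrite a0; exact: block_isolated.
have [e [s [s0 sS ea ecof s_lt]]] := opow_fundamental a0.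
pose h n := ord_add g (s n).
have h0 : h 0%N = g by rewrite /h s0 ord_add0.
have hS n : h n.+1 = ord_add (h n) (opow (e n)) by rewrite /h sS ord_addA.
have h_ltS n : h n < h n.+1 by rewrite hS -[ltLHS]ord_add0 ord_add_lt// opow_gt0.
have h_le m n : (m <= n)%N -> h m <= h n.
  elim: n => [|n IHn]; first by rewrite leqn0 => /eqP->.
  rewrite leq_eqVlt => /predU1P[->//|/IHn/le_trans]; apply.
  exact/ltW/h_ltS.
have h_p n : h n < v p.
  rewrite pE; apply: ord_add_lt; apply/s_lt; exists n.+1.
  by rewrite sS -[ltLHS]ord_add0 ord_add_lt// opow_gt0.
have p_lt c : c < v p -> exists n, c < h n.
  rewrite pE => /ord_add_ltP[cg|[d /s_lt[n dn] ->]]; first by exists 0%N; rewrite h0.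
  by exists n; exact: ord_add_lt.
have h_ge1 n : ord_one <= h n.+1.
  by apply: (ord_succP ord_zero).2; apply: le_lt_trans (h_ltS n); exact: ord0_le.
have h_lam n : h n.+1 <= lam by exact: le_trans (ltW (h_p _)) (ord_val_le p).
pose q n := ord_point (h_ge1 n) (h_lam n).
have -> : ord_segment g (ord_add g (opow a)) =
    [set p] `|` \bigcup_n ord_segment (h n) (h n.+1).
  rewrite -pE; apply/seteqP; split=> x.
    move=> /andP[gx]; rewrite le_eqVlt => /predU1P[/ord_val_inj->|/p_lt[n]].
      by left.
    (* A point with value [h n] is the last point of the preceding segment; the value [h 0] is [g],
       which is excluded. *)
    move=> xn; right; elim: n xn => [|n IHn xn]; first by rewrite h0 ltNge ltW.
    have [/IHn//|hx] := ltP (v x) (h n).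
    move: hx; rewrite le_eqVlt => /predU1P[hx|hx]; last first.
      by exists n => //; rewrite ord_segmentE hx ltW.
    case: n => [|n] in hx xn IHn *; first by move: gx; rewrite -hx h0 ltxx.
    by exists n => //; rewrite ord_segmentE -hx h_ltS lexx.
  move=> [->|[n _]]; rewrite !ord_segmentE.
    by rewrite lexx andbT -h0 h_p.
  move=> /andP[nx xn]; rewrite (le_lt_trans _ nx)/=; last by rewrite -h0; exact: h_le.
  exact: le_trans xn (ltW (h_p _)).
apply: (@block_cluster _ a p e _ q) => //.
- by move=> n; rewrite hS; apply: IH => //; rewrite -hS; exact: ord_val_point.
- by move=> n; exact: clopen_ord_segment.
- by move=> n; rewrite ord_segmentE leNgt (h_p n.+1) andbF.
- have disj m n x : (m < n)%N -> ord_segment (h m) (h m.+1) x ->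
      ~ ord_segment (h n) (h n.+1) x.
    move=> mn /andP[_ xm] /andP[nx _].
    by have := lt_le_trans nx (le_trans xm (h_le _ _ mn)); rewrite ltxx.
  apply/trivIsetP => m n _ _; rewrite neq_ltn => /orP[] mn.
    by apply/seteqP; split=> // x [xm]; exact: disj mn xm.
  by apply/seteqP; split=> // x [/[swap] xm]; exact: disj mn xm.
- move=> V /nbhs_ord_segment[c /p_lt[N cN] cV]; exists N => n Nn x /andP[nx xn].
  apply: cV; rewrite ord_segmentE (lt_le_trans cN)/=; last first.
    exact: le_trans (h_le _ _ Nn) (ltW nx).
  exact: le_trans xn (ltW (h_p _)).
Qed.

End ordinal_interval.

(** The interval [1, omega^a] is the segment ]0, 0 + omega^a]. *)
Lemma itv1_omega_exp_block (a : omega1) :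
  exists p, block a [set: itv1_omega_exp a] p.
Proof.
have l1 : (ord_one <= ord_exp ord_omega a <= ord_exp ord_omega a)%O.
  by rewrite lexx andbT; apply: (ord_succP ord_zero).2; exact: opow_gt0.
have /andP[l1' l1''] := l1; pose p0 := ord_point l1' l1''; exists p0.
have := @block_ord_segment (ord_exp ord_omega a) a ord_zero p0.
rewrite ord_add0l; have -> : ord_segment ord_zero (ord_exp ord_omega a) =
    [set: order_topology (ord_itv1 (ord_exp ord_omega a))].
  apply/seteqP; split=> // x _; rewrite ord_segmentE.
  have /andP[x1 ->] := ord_valP x; rewrite andbT.
  by apply: lt_le_trans x1; rewrite ord_ltS.
by apply; exact: SubK.
Qed.

(** * Cantor-Bendixson derivatives and disjoint open sets *)

Section CB_derivatives.
Variable K : topologicalType.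
Local Notation CB := (CB_derivative K).
Implicit Types (a b : omega1) (x y : K).

Lemma CB_derivative0 : CB ord_zero = setT.
Proof. exact: ord_rec0. Qed.

Lemma CB_derivativeS a : CB (ord_succ a) = accumulation (CB a).
Proof. exact: ord_recS. Qed.

Lemma CB_derivative_lim a : ord_limit a ->
  CB a = \bigcap_(b in [set b | (b < a)%O]) CB b.
Proof.
move=> la; rewrite /CB_derivative ord_rec_lim//; apply/seteqP; split=> x xa.
  by move=> b ba; apply: xa; exists b.
by move=> _ [b ba <-]; exact: xa.
Qed.

Lemma CB_derivative_anti a b : (b <= a)%O -> CB a `<=` CB b.
Proof.
elim/(well_founded_ind omega1_wf): a => a IH.
rewrite le_eqVlt => /predU1P[->//|ba].
have [a0|[[c ac]|la]] := ord_cases a.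
- by move: ba; rewrite a0 ord_lt0.
- rewrite ac CB_derivativeS => x [+ _]; apply: IH; first by rewrite ac ord_ltS.
  by rewrite -ord_ltS -ac.
- by rewrite CB_derivative_lim// => x; exact.
Qed.

(** A description uniform in [a], which spares later inductions the distinction between successors
    and limits. *)
Lemma CB_derivativeP a x :
  CB a x <-> forall b, (b < a)%O -> limit_point (CB b) x.
Proof.
elim/(well_founded_ind omega1_wf): a => a IH; split=> [xa b ba|xa].
  have : CB (ord_succ b) x by exact: CB_derivative_anti ((ord_succP b).2 _ ba) _ xa.
  by rewrite CB_derivativeS => -[].
have CBx b : (b < a)%O -> CB b x.
  by move=> ba; apply/(IH _ ba) => c /lt_trans/(_ ba)/xa.
have [->|[[c ac]|la]] := ord_cases a; first by rewrite CB_derivative0.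
  have ca : (c < a)%O by rewrite ac ord_ltS.
  by rewrite ac CB_derivativeS; split; [exact: CBx|exact: xa].
by rewrite CB_derivative_lim.
Qed.

(** Neighbourhoods [V n] of x are shrunk recursively. At stage n, [V n] contains a point y <> x of
    K^(e n); separating y from x yields the open set [W n] around y and a smaller neighbourhood
    [V n.+1] disjoint from it, inside which all later sets are chosen. *)
Lemma CB_derivative_disjoint_open a (e : nat -> omega1) (U : set K) x :
  hausdorff_space K -> CB a x -> (forall n, (e n < a)%O) -> open U -> U x ->
  exists W : nat -> set K, [/\ forall n, open (W n), forall n, W n `<=` U,
    forall n, ~ W n x, trivIset setT W & forall n, CB (e n) `&` W n !=set0].
Proof.
move=> hK /CB_derivativeP xa ea oU Ux.
pose S := {V : set K | open V /\ V x}.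
have step (n : nat) (V : S) : exists VW : S * set K,
    [/\ sval VW.1 `<=` sval V, open VW.2, VW.2 `<=` sval V,
      VW.2 `&` sval VW.1 = set0 & CB (e n) `&` VW.2 !=set0].
  case: V => V /= [oV Vx].
  have [y [yx CBy Vy]] := xa _ (ea n) _ (open_nbhs_nbhs (conj oV Vx)).
  have := hK; rewrite open_hausdorff => /(_ _ _ yx)[[A B] /= [/set_mem yA /set_mem xB] [oA oB /eqP AB0]].
  exists (exist _ (V `&` B) (conj (openI oV oB) (conj Vx xB)), V `&` A) => /=.
  split.
  - by move=> z [].
  - exact: (openI oV oA).
  - by move=> z [].
  - by apply/seteqP; split=> // z [[_ Az] [_ Bz]]; rewrite -AB0; split.
  - by exists y.
have [f fP] : exists f : nat -> S -> S * set K, forall n V,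
    [/\ sval (f n V).1 `<=` sval V, open (f n V).2, (f n V).2 `<=` sval V,
      (f n V).2 `&` sval (f n V).1 = set0 & CB (e n) `&` (f n V).2 !=set0].
  exists (fun n V => sval (cid (step n V))) => n V; exact: svalP (cid (step n V)).
pose V := fix V n : S := if n is k.+1 then (f k (V k)).1 else exist _ U (conj oU Ux).
pose W n := (f n (V n)).2.
have V_le m n : (m <= n)%N -> sval (V n) `<=` sval (V m).
  elim: n => [|n IHn]; first by rewrite leqn0 => /eqP->.
  rewrite leq_eqVlt => /predU1P[->//|/IHn]; apply: subset_trans.
  by have [] := fP n (V n).
have WV n : W n `<=` sval (V n) by have [] := fP n (V n).
have WV0 n : W n `&` sval (V n.+1) = set0 by have [] := fP n (V n).
exists W; split=> [n|n|n Wx||n].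
- by have [] := fP n (V n).
- exact: subset_trans (WV n) (V_le 0%N n _).
- by have : (W n `&` sval (V n.+1)) x by [split=> //; exact: (svalP (V n.+1)).2]; rewrite WV0.
- have disj m n z : (m < n)%N -> W m z -> ~ W n z.
    move=> mn Wm /WV/(V_le _ _ mn) Vz.
    have : (W m `&` sval (V m.+1)) z by [].
    by rewrite WV0.
  apply/trivIsetP => m n _ _; rewrite neq_ltn => /orP[] mn.
    by apply/seteqP; split=> // z [zm]; exact: disj mn zm.
  by apply/seteqP; split=> // z [/[swap] zm]; exact: disj mn zm.
- by have [] := fP n (V n).
Qed.

End CB_derivatives.

(** Choose a point of C in each [U i], and let y be a cluster point of these along the cofinite
    filter on D. A set [U i] containing y would contain chosen points of other indices, against
    disjointness. *)
Lemma compact_disjoint_open (M : topologicalType) (C : set M) (I : Type)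
    (D : set I) (U : I -> set M) :
  compact C -> ~ finite_set D -> (forall i, D i -> open (U i)) ->
  trivIset D U ->
  (forall i, D i -> C `&` U i !=set0) ->
  exists2 y, C y & forall i, D i -> ~ U i y.
Proof.
move=> cC infD oU Udisj CU.
have [i0 Di0] : D !=set0.
  by apply/set0P/eqP => D0; apply: infD; rewrite D0.
have /choice[x xP] : forall i, exists m, D i -> C m /\ U i m.
  move=> i; have [/CU[m Cm]|nD] := pselect (D i); first by exists m.
  by have [m _] := CU _ Di0; exists m.
pose F : set_system M := fun A => finite_set (D `\` x @^-1` A).
have FF : ProperFilter F.
  split; first by rewrite /F preimage_set0 setD0.
  split=> [|A B FA FB|A B AB].
  - by rewrite /F preimage_setT setDT.
  - by rewrite /F preimage_setI setDIr finite_setU.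
  - by apply: sub_finite_set => i [Di nB]; split=> // /AB.
have [|y [Cy Fy]] := cC F FF.
  rewrite /F; suff -> : D `\` x @^-1` C = set0 by [].
  by apply/seteqP; split=> // i [Di]; apply; exact: (xP i Di).1.
exists y => // i Di Uy.
have [|m [/= [j [Dj ji] <-] Ujx]] :=
    Fy (x @` (D `\ i)) (U i) _ (open_nbhs_nbhs (conj (oU _ Di) Uy)).
  apply: (@sub_finite_set _ _ [set i]) => // j [Dj nj]; apply: contrapT => ji.
  by apply: nj; exists j.
apply: ji; apply/esym/Udisj => //; exists (x j); split=> //.
exact: (xP j Dj).2.
Qed.

(* This covers both cases of [K_copies]: with finitely many copies the
   convergence clause is void and p is any point, so it may lie in a copy. *)
Definition limit_family (L M : topologicalType) (G : Type) (j : G -> L -> M)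
    (p : M) : Prop :=
  [/\ forall g x g' x', j g x = j g' x' -> g = g',
      forall g, injective (j g) /\ continuous (j g),
      forall g D, clopen D -> clopen (j g @` D),
      forall y, y = p \/ exists g x, y = j g x &
      forall V, nbhs p V -> finite_set [set g | ~ range (j g) `<=` V]].

(** With infinitely many copies p is the point at infinity; with finitely many it is a point of some
    copy. The final disjunction is what later ensures that the value at p is attained over K. *)
Lemma K_copies_family (G : Type) (L : topologicalType) :
  compact [set: L] -> [set: L] !=set0 -> inhabited G ->
  exists (j : G -> L -> K_copies G L) (p : K_copies G L), limit_family j p /\
    compact [set: K_copies G L] /\
    ((exists g x, j g x = p) \/ ~ finite_set [set: G]).
Proof.
move=> cL [l0 _] [g0].
pose ex (g : G) (x : L) : copies G L := existT (fun _ : {classic G} => L) (g : {classic G}) x.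
have ex_inj g g' x x' : ex g x = ex g' x' -> g = g' /\ x = x'.
  by move=> E; split; [exact: (congr1 (@projT1 _ _) E)|exact: (congr1 (fun z => projT2 z : L) E)].
have ex_cont g : continuous (ex g) by exact: existT_continuous.
have ex_open g D : open D -> open (ex g @` D) by exact: existT_open_map.
have ex_closed g D : closed D -> closed (ex g @` D).
  move=> cD.
  have -> : ex g @` D = ~` (ex g @` (~` D) `|` \bigcup_(h in [set h | h <> g]) range (ex h)).
    apply/seteqP; split=> [_ [x Dx <-] [[y nDy /ex_inj[_ yx]]|[h hg [y _ /ex_inj[hg' _]]]]|[h x]].
    - by apply: nDy; rewrite yx.
    - exact: hg.
    - move=> /not_orP[nD nh].
      have hg : h = g.
        by apply: contrapT => hg; apply: nh; exists h => //; exists x.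
      rewrite hg in nD *; exists x => //.
      by apply: contrapT => nDx; apply: nD; exists x.
  apply: open_closedC; apply: openU; first by apply: ex_open; exact: closed_openC.
  by apply: bigcup_open => h _; apply: ex_open; exact: openT.
have ex_compact g : compact (range (ex g)).
  apply: continuous_compact => //.
  exact/continuous_subspaceT/ex_cont.
have [[finG ->]|[infG ->]] : (finite_set [set: G] /\ K_copies G L = copies G L) \/
    (~ finite_set [set: G] /\ K_copies G L = one_point_compactification (copies G L)).
  by rewrite /K_copies; case: pselect => ?; [left|right].
  exists ex, (ex g0 l0); split; last split; last by left; exists g0, l0.
    split=> [g x g' x' /ex_inj[]//|g|g D [oD cD]|[g x]|V _].
    - by split=> [x x' /ex_inj[]|].
    - by split; [exact: ex_open|exact: ex_closed].
    - by right; exists g, x.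
    - exact: (sub_finite_set (@subsetT _ _) finG).
  exact: (@sigT_compact {classic G} (fun=> L)).
have sex_inj g g' x x' : Some (ex g x) = Some (ex g' x') -> g = g' /\ x = x'.
  by move=> /Some_inj/ex_inj.
exists (fun g x => Some (ex g x)), None; split; last split; last by right.
  split=> [g x g' x' /sex_inj[]//|g|g D [oD cD]|[[g x]|]|V [C [cC clC] CV]].
  - split=> [x x' /sex_inj[]//|x].
    apply: (@cvg_comp _ _ _ (ex g) Some _ _ _ (ex_cont g x)).
    exact: (@one_point_compactification_some_continuous (copies G L)).
  - rewrite -(image_comp (ex g) Some D); split.
      by apply: one_point_compactification_open_some; exact: ex_open.
    (* The complement of the image is a neighbourhood of each of its finite points by closedness in
       the disjoint union, and of infinity because the image of D is compact and closed there. *)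
    rewrite -openC openE => -[z nz|_].
      rewrite /interior; have : nbhs z (~` (ex g @` D)).
        apply: open_nbhs_nbhs; split; first by apply: closed_openC; exact: ex_closed.
        by move=> zD; apply: nz; exists z.
      apply: (@filterS (copies G L)) => w nw [w' + [ww']].
      by rewrite ww'.
    exists (ex g @` D).
      split; last exact: ex_closed.
      apply: continuous_compact; first exact/continuous_subspaceT/ex_cont.
      exact: subclosed_compact cL (@subsetT _ _).
    by move=> _ [[w nw <-]|->] [w' // + [ww']]; rewrite ww'.
  - by right; exists g, x.
  - by left.
  (* The compact set C meets only finitely many copies: otherwise [compact_disjoint_open] would give
     a point of C outside every copy that meets C. *)
  - pose D := [set g | C `&` range (ex g) !=set0].
    apply: (@sub_finite_set _ _ D) => [g /existsNP[y /not_implyP[[x _ <-] nV]]|].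
      exists (ex g x); split; last by exists x.
      by apply: contrapT => nC; apply: nV; apply: CV; left; exists (ex g x).
    apply: contrapT => infD.
    have [| | |[h x] Cy] := @compact_disjoint_open _ C G D (fun g => range (ex g)) cC infD.
    + by move=> g _; apply: ex_open; exact: openT.
    + by move=> g h _ _ [_ [[x _ <-] [y _ /ex_inj[]]]].
    + by [].
    by move=> /(_ h); apply; [exists (ex h x); split => //; exists x|exists x].
exact: one_point_compactification_compact.
Qed.

(** * Gluing over disjoint open sets *)

Section gluing.
Local Open Scope ring_scope.

Lemma continuous_at_near_eq (X Y : topologicalType) (f g : X -> Y) (N : set X) (x : X) :
  nbhs x N -> (forall z, N z -> f z = g z) -> {for x, continuous g} ->
  {for x, continuous f}.
Proof.
move=> nN fg gx V; rewrite fg; last exact: nbhs_singleton.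
by move=> /gx; apply: filterS2 nN => z /fg/=; rewrite /preimage/= => ->.
Qed.

Lemma nbhs_finite_bigcap (X : topologicalType) (I : Type) (J : set I)
    (V : I -> set X) (x : X) :
  finite_set J -> (forall i, J i -> nbhs x (V i)) -> nbhs x (\bigcap_(i in J) V i).
Proof.
(* [Pchoice] equips the bare index type with the choice structure that finite sets require. *)
move: J V; elim/Pchoice: I => I J V /finite_fsetP[F ->] nV.
by apply: filter_bigI => i Fi; exact: nV.
Qed.

Variables (K : topologicalType) (I : Type) (U : I -> set K).
Hypotheses (oU : forall i, open (U i)) (tU : trivIset [set: I] U).

(** The index is picked by choice; disjointness of the sets [U i] makes it unique, see [glue_in]. *)
Definition glue (Y : Type) (h : I -> K -> Y) (h0 : K -> Y) (x : K) : Y :=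
  if pselect (exists i, U i x) is left e then h (sval (cid e)) x else h0 x.

Lemma glue_in (Y : Type) (h : I -> K -> Y) h0 i x : U i x -> glue h h0 x = h i x.
Proof.
move=> Ux; rewrite /glue; case: pselect => [e|[]]; last by exists i.
have Uex := svalP (cid e).
by have -> : sval (cid e) = i by apply: (@tU (sval (cid e)) i) => //; exists x.
Qed.

Lemma glue_out (Y : Type) (h : I -> K -> Y) h0 x :
  (forall i, ~ U i x) -> glue h h0 x = h0 x.
Proof.
move=> nU; rewrite /glue; case: pselect => // e.
by case: (nU _ (svalP (cid e))).
Qed.

(** Near a point outside all [U i], only the finitely many indices whose image leaves V matter; the
    corresponding [U i] are closed, so a neighbourhood avoids them. *)
Lemma glue_clopen_continuous (M : topologicalType) (h : I -> K -> M) (p : M) :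
  (forall i, closed (U i)) -> (forall i, continuous (h i)) ->
  (forall V, nbhs p V -> finite_set [set i | ~ h i @` U i `<=` V]) ->
  continuous (glue h (fun=> p)).
Proof.
move=> cU ch hp x; have [[i Ux]|/forallNP nU] := pselect (exists i, U i x).
  apply: (continuous_at_near_eq (open_nbhs_nbhs (conj (oU i) Ux))) (ch i x) => z.
  exact: glue_in.
move=> V; rewrite glue_out// => /[dup] /nbhs_singleton Vp /hp finV.
have := @nbhs_finite_bigcap _ _ _ (fun i => ~` U i) x finV; set N := bigcap _ _ => nN.
apply: (@filterS _ _ _ N) (nN _) => [z Nz|i _]; last first.
  by apply: open_nbhs_nbhs; split; [exact: closed_openC|exact: nU].
rewrite /preimage/=; have [[i Uz]|/forallNP nUz] := pselect (exists i, U i z); last first.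
  by rewrite glue_out.
rewrite (glue_in _ _ Uz); apply: contrapT => nV; apply: (Nz i) => // hV; apply: nV.
by apply: hV; exists z.
Qed.

(** Here the [U i] need not be closed. At a point outside all of them each [h i] vanishes, so by
    continuity the finitely many that can exceed eps are small nearby. *)
Lemma glue_zero_continuous (R : realType) (h : I -> K -> R) :
  (forall i, continuous (h i)) -> (forall i x, ~ U i x -> h i x = 0) ->
  (forall eps, 0 < eps -> finite_set [set i | exists x, eps < `|h i x|]) ->
  continuous (glue h (fun=> 0)).
Proof.
move=> ch hU hp x; have [[i Ux]|/forallNP nU] := pselect (exists i, U i x).
  apply: (continuous_at_near_eq (open_nbhs_nbhs (conj (oU i) Ux))) (ch i x) => z.
  exact: glue_in.
have g0 : glue h (fun=> 0) x = 0 by rewrite glue_out.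
apply/(@cvgrPdist_le _ R^o) => eps eps0; rewrite g0.
have := @nbhs_finite_bigcap _ _ _ (fun i => [set z | `|h i z| < eps]) x (hp _ eps0).
set N := bigcap _ _ => nN; apply: (@filterS _ _ _ N) (nN _) => [z Nz|i _]; last first.
  have := ch i x; rewrite /continuous_at hU//.
  move=> /(@cvgrPdist_lt _ R^o)/(_ _ eps0); apply: filterS => z.
  by rewrite sub0r normrN.
rewrite sub0r normrN; have [[i Uz]|/forallNP nUz] := pselect (exists i, U i z); last first.
  by rewrite glue_out// normr0 ltW.
rewrite (glue_in _ _ Uz) leNgt; apply/negP => hz.
by have := Nz i (ex_intro _ z hz); rewrite /= ltNge ltW.
Qed.

End gluing.

Section contfun_norm.
Local Open Scope ring_scope.
Variables (R : realType) (K : topologicalType).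
Implicit Types f g : contfun R K.

Lemma contfun_scaleE a f x : (a *: f) x = a * f x. Proof. by []. Qed.
Lemma contfun_addE f g x : (f + g) x = f x + g x. Proof. by []. Qed.
Lemma contfun_oppE f x : (- f) x = - f x. Proof. by []. Qed.
Lemma contfun_oneE x : (1 : contfun R K) x = 1. Proof. by []. Qed.

Definition contfunE :=
  (contfun_scaleE, contfun_addE, contfun_oppE, contfun_oneE).

Lemma contfun_continuous f : continuous (f : K -> R).
Proof. exact: cts_fun. Qed.

Lemma contfun_norm_continuous f : continuous (fun x => `|f x|).
Proof. by move=> x; apply: cvg_norm; exact: cts_fun. Qed.

Lemma sup_norm_le f c : [set: K] !=set0 -> (forall x, `|f x| <= c) ->
  sup_norm f <= c.
Proof.
move=> [x0 _] fc; apply: ge_sup; first by exists `|f x0|, x0.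
by move=> _ [x _ <-].
Qed.

Hypothesis cK : compact [set: K].

Lemma sup_norm_attained f : [set: K] !=set0 ->
  exists x, sup_norm f = `|f x| /\ forall y, `|f y| <= `|f x|.
Proof.
move=> K0.
have [x _ xmax] : exists2 x, x \in [set: K] & forall y, y \in [set: K] -> `|f y| <= `|f x|.
  apply: compact_EVT_max => //.
  exact/continuous_subspaceT/contfun_norm_continuous.
have {}xmax y : `|f y| <= `|f x| by apply: xmax; rewrite inE.
exists x; split=> //; apply/le_anti; rewrite sup_norm_le//=.
apply: ub_le_sup; last by exists x.
by exists `|f x| => _ [y _ <-].
Qed.

Lemma sup_norm_ge f x : `|f x| <= sup_norm f.
Proof.
have [|y [-> fy]] := sup_norm_attained f; last exact: fy.
by exists x.
Qed.

End contfun_norm.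

Section clopen_indicator.
Local Open Scope ring_scope.
Variables (R : realType) (M : topologicalType).

Lemma clopen_indic_continuous (D : set M) :
  clopen D -> continuous (\1_D : M -> R).
Proof.
move=> [oD cD] x; have [Dx|nDx] := pselect (D x).
  apply: (@continuous_at_near_eq _ R _ (fun=> 1) D); last exact: cvg_cst.
    exact: open_nbhs_nbhs.
  by move=> z Dz; rewrite indicE mem_set.
apply: (@continuous_at_near_eq _ R _ (fun=> 0) (~` D)); last exact: cvg_cst.
  by apply: open_nbhs_nbhs; split=> //; exact: closed_openC.
by move=> z Dz; rewrite indicE memNset.
Qed.

Definition clopen_indic (D : set M) (cD : clopen D) : contfun R M :=
  pack_contfun (@clopen_indic_continuous D cD).

Lemma clopen_indicE D (cD : clopen D) x : clopen_indic cD x = \1_D x.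
Proof. by []. Qed.

Lemma clopen_indic_in D (cD : clopen D) x : D x -> clopen_indic cD x = 1.
Proof. by move=> Dx; rewrite clopen_indicE indicE mem_set. Qed.

Lemma clopen_indic_out D (cD : clopen D) x : ~ D x -> clopen_indic cD x = 0.
Proof. by move=> Dx; rewrite clopen_indicE indicE memNset. Qed.

Lemma clopen_indic_bound D (cD : clopen D) x : 0 <= clopen_indic cD x <= 1.
Proof.
have [/clopen_indic_in->|/clopen_indic_out->] := pselect (D x).
  by rewrite ler01 lexx.
by rewrite ler01 lexx.
Qed.

End clopen_indicator.

(** * From isometries to cellular families *)

Section isometries.
Local Open Scope ring_scope.
Variables (R : realType) (M K : topologicalType).
Hypotheses (cM : compact [set: M]) (cK : compact [set: K]).
Hypotheses (M0 : [set: M] !=set0) (K0 : [set: K] !=set0).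
Variable T : {linear contfun R M -> contfun R K}.
Hypothesis Tiso : isometric T.
Implicit Types f : contfun R M.

(* Testing T on the functions N 1_p +- g, with N the norm of g, shows that T g
   vanishes where the image of the indicator of p has absolute value 1. *)
Lemma isometric_isolated_point p : clopen [set p] ->
  exists y, forall f, `|T f y| = `|f p|.
Proof.
move=> cp; pose phi := clopen_indic R cp.
have phip : phi p = 1 by exact: clopen_indic_in.
have phiN x : x <> p -> phi x = 0 by move=> xp; exact: clopen_indic_out.
have [y [Ty _]] := sup_norm_attained cK (T phi) K0.
have {}Ty : `|T phi y| = 1.
  rewrite -Ty Tiso; apply/le_anti; rewrite sup_norm_le//=; last first.
    by move=> x; have /andP[? ?] := clopen_indic_bound R cp x; rewrite ger0_norm.
  by rewrite -(normr1 R) -phip sup_norm_ge.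
have Tg0 (g : contfun R M) : g p = 0 -> T g y = 0.
  move=> gp; set N := sup_norm g.
  have bound (s : R) : `|s| = 1 -> `|N * T phi y + s * T g y| <= N.
    move=> s1; have -> : N * T phi y + s * T g y = T (N *: phi + s *: g) y.
      by rewrite linearD !linearZ.
    apply: le_trans (sup_norm_ge cK _ _) _; rewrite Tiso; apply: sup_norm_le => // x.
    have N0 : 0 <= N by apply: le_trans (sup_norm_ge cM g p).
    rewrite !contfunE; have [->|/phiN->] := pselect (x = p).
      by rewrite gp phip mulr0 addr0 mulr1 ger0_norm.
    by rewrite mulr0 add0r normrM s1 mul1r sup_norm_ge.
  have := bound 1; have := bound (-1); rewrite normrN normr1 => /(_ erefl) + /(_ erefl).
  rewrite !ler_norml mulN1r mul1r.
  have N0 : 0 <= N by apply: le_trans (sup_norm_ge cM g p).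
  move: Ty; case: (lerP 0 (T phi y)) => t0.
    by rewrite ger0_norm// => ->; lra.
  rewrite ltr0_norm// => /(congr1 -%R); rewrite opprK => ->; lra.
exists y => f; have -> : f = f p *: phi + (f - f p *: phi) by rewrite addrC subrK.
rewrite linearD linearZ !contfunE (Tg0 (f - _)); last first.
  by rewrite !contfunE phip mulr1 subrr.
by rewrite phip !mulr1 !addr0 normrM Ty mulr1 subrr addr0.
Qed.

Lemma isometric_block a B p : block a B p ->
  exists2 y, CB_derivative K a y & forall f, `|T f y| = `|f p|.
Proof.
elim=> {a B p} [p cp|a p e B q bB IH cB Bp tB Bcvg ea ecof].
  have [y Ty] := isometric_isolated_point cp.
  by exists y => //; rewrite CB_derivative0.
have /choice[y yP] : forall n, exists y,
    CB_derivative K (e n) y /\ forall f : contfun R M, `|T f y| = `|f (q n)|.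
  by move=> n; have [y] := IH n; exists y.
have Bq n : B n (q n) by exact: block_mem (bB n).
(* Since [q n] tends to p, continuity of f and [T f] carries the equalities at [y n] over to the
   cluster point z. *)
have [z [_ zy]] := cK (fmap_proper_filter y eventually_filter) (@filterT _ (y @ \oo) _).
have zP (V : set K) N : nbhs z V -> exists2 n, (N <= n)%N & V (y n).
  move=> nV; have [|_ [[n /= Nn <-] Vn]] := zy (y @` [set n | (N <= n)%N]) V _ nV.
    by exists N => // n /= Nn; exists n.
  by exists n.
have Tz (f : contfun R M) : `|T f z| = `|f p|.
  apply/eqP; rewrite -subr_eq0 -normr_le0; apply/ler_addgt0Pr => eps eps0; rewrite add0r.
  have eps2 : 0 < eps / 2 by rewrite divr_gt0.
  have /(@cvgrPdist_lt _ R^o)/(_ _ eps2) nf : `|f x| @[x --> p] --> `|f p|.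
    exact: contfun_norm_continuous.
  have /(@cvgrPdist_lt _ R^o)/(_ _ eps2) nT : `|T f x| @[x --> z] --> `|T f z|.
    exact: contfun_norm_continuous.
  have [N BN] := Bcvg _ nf; have [n /BN/(_ _ (Bq n))/= fq] := zP _ N nT.
  rewrite /= (yP n).2; move: fq.
  set u := `|f p|; set v := `|f (q n)|; set w := `|T f z|.
  by rewrite ler_norml !ltr_norml => /andP[? ?] /andP[? ?]; apply/andP; split; lra.
(* The image of the indicator of [B n] has absolute value 1 at [y n] but 0 at z, as p is not in
   [B n]. Hence z is a limit point of the [y n], whose ranks eventually exceed any b < a or equal
   it. *)
have yz n : y n <> z.
  move=> ynz; have := Tz (clopen_indic R (cB n)); rewrite -ynz (yP n).2.
  rewrite clopen_indic_in// clopen_indic_out// normr1 normr0 => /eqP.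
  by rewrite oner_eq0.
exists z => //; apply/CB_derivativeP => b ba V nV.
have [N be] := ecof _ ba; have [n Nn Vn] := zP _ N nV.
exists (y n); split=> //; first exact/eqP.
exact: CB_derivative_anti (be _ Nn) _ (yP n).1.
Qed.

(** For distinct copies g and h the functions [phi g + phi h] and [phi g - phi h] are bounded by 1,
    hence so are their images, and [T (phi g)] and [T (phi h)] cannot both exceed 1/2 in absolute
    value. Each set meets the derivative at the point that [isometric_block] attaches to the last
    point of the copy. *)
Lemma isometric_family_cellular (a : omega1) (L : topologicalType) (G : Type)
    (j : G -> L -> M) (p : M) (l : L) :
  block a [set: L] l -> limit_family j p ->
  exists U : G -> set K, [/\ forall g, open (U g), trivIset [set: G] U &
    forall g, CB_derivative K a `&` U g !=set0].
Proof.
move=> bl [jdisj jcont jclopen _ _].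
have cj g : clopen (range (j g)) by exact/jclopen/clopenT.
pose phi g := clopen_indic R (cj g).
exists (fun g => [set y | 2^-1 < `|T (phi g) y|]); split=> [g|g h _ _ [y [/= gy hy]]|g].
- rewrite (_ : [set y | _] = (fun y => `|T (phi g) y|) @^-1` [set x | 2^-1 < x])//.
  apply: open_comp; first by move=> y _; exact: contfun_norm_continuous.
  exact: open_gt.
- apply: contrapT => gh.
  have bound (s : R) : `|s| = 1 -> `|T (phi g) y + s * T (phi h) y| <= 1.
    move=> s1; have -> : T (phi g) y + s * T (phi h) y = T (phi g + s *: phi h) y.
      by rewrite linearD linearZ.
    apply: le_trans (sup_norm_ge cK _ _) _; rewrite Tiso; apply: sup_norm_le => // x.
    rewrite !contfunE; have [[u _ <-]|nx] := pselect (range (j g) x).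
      rewrite [phi h _]clopen_indic_out ?mulr0 ?addr0; last first.
        by move=> [v _ /jdisj/esym].
      by have /andP[? ?] := clopen_indic_bound R (cj g) (j g u); rewrite ger0_norm.
    rewrite [phi g _]clopen_indic_out// add0r normrM s1 mul1r.
    by have /andP[? ?] := clopen_indic_bound R (cj h) x; rewrite ger0_norm.
  have := bound 1; have := bound (-1); rewrite normrN normr1 => /(_ erefl) + /(_ erefl).
  rewrite mulN1r mul1r !ler_norml => /andP[? ?] /andP[? ?].
  by move: gy hy {gh bound}; rewrite !ltr_normr => /orP[?|?] /orP[?|?]; lra.
- have [jinj jc] := jcont g.
  have [y CBy Ty] := isometric_block (@block_image _ _ _ _ _ _ jinj jc (jclopen g) bl).
  exists y; split=> //=; rewrite Ty [phi g _]clopen_indic_in//.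
  by rewrite normr1; lra.
Qed.

End isometries.

(** * From cellular families to positive isometries *)

Section local_embeddings.
Local Open Scope ring_scope.
Variables (R : realType) (M K : topologicalType).
Implicit Types f : contfun R M.

(* The last clause says that every point of B is represented by a point of U,
   which makes T isometric on functions living on B. *)
Definition local_embedding (B : set M) (U : set K)
    (T : contfun R M -> contfun R K) : Prop :=
  [/\ linear T,
      forall f x, ~ U x -> T f x = 0,
      forall f, (forall m, B m -> 0 <= f m) -> forall x, 0 <= T f x,
      forall x, T 1 x <= 1 &
      forall q, B q -> exists2 y, U y & forall f, T f y = f q].

(** Both c + f and c - f are nonnegative on B, so positivity bounds [T f] in absolute value by c
    times [T 1], which is at most c. *)
Lemma local_embedding_norm_le B U T f (c : R) : local_embedding B U T -> 0 <= c ->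
  (forall m, B m -> `|f m| <= c) -> forall x, `|T f x| <= c.
Proof.
move=> [Tlin _ Tpos T1 _] c0 fc x.
have TE (s : R) : T (c *: (1 : contfun R M) + s *: f) x = c * T 1 x + s * T f x.
  (* [Tlin] handles only combinations [a *: u + v], so a zero summand is added, whose image is shown
     to vanish. *)
  rewrite -[s *: f]addr0.
  have T0 : T 0 = 0 by have := Tlin (-1) 0 0; rewrite !scaler0 addr0 scaleN1r addNr.
  by rewrite !Tlin T0 !contfunE addr0.
have pos (s : R) : `|s| = 1 -> 0 <= c * T 1 x + s * T f x.
  move=> s1; rewrite -TE; apply: Tpos => m /fc fm; rewrite !contfunE mulr1.
  have : `|s * f m| <= c by rewrite normrM s1 mul1r.
  by rewrite ler_norml => /andP[? _]; lra.
have := pos 1; have := pos (-1); rewrite normrN normr1 => /(_ erefl) + /(_ erefl).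
have cT : c * T 1 x <= c by rewrite -[leRHS]mulr1 ler_wpM2l.
by rewrite ler_norml => ? ?; apply/andP; split; lra.
Qed.

Section glue_embeddings.
Variables (I : Type) (B : I -> set M) (U : I -> set K).
Variables (T : I -> contfun R M -> contfun R K) (p : M) (phi : contfun R K).
Hypotheses (oU : forall i, open (U i)) (tU : trivIset [set: I] U).
Hypothesis TP : forall i, local_embedding (B i) (U i) (T i).
Hypothesis Bp : forall V, nbhs p V -> finite_set [set i | ~ B i `<=` V].
Hypothesis phi1 : forall i x, U i x -> phi x = 1.

(** The operator is f(p) phi plus the glued functions T i (f - f(p)). For all but finitely many i, f
    is within eps of f(p) on [B i], so T i (f - f(p)) is bounded by eps, which gives continuity. The
    expression on [U i] shows positivity, since 1 - T i 1 >= 0. *)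
Lemma glue_embeddings : exists T' : contfun R M -> contfun R K,
  [/\ linear T',
      forall f x, (forall i, ~ U i x) -> T' f x = f p * phi x &
      forall i f x, U i x -> T' f x = T i f x + f p * (1 - T i 1 x)].
Proof.
pose s (f : contfun R M) := glue U (fun i => T i (f - f p *: (1 : contfun R M))) (fun=> 0).
have sc f : continuous (s f).
  apply: glue_zero_continuous => // [i|i x nUx|eps eps0].
  - exact: contfun_continuous.
  - by have [_ -> ] := TP i.
  - have nf : nbhs p [set m | `|f p - f m| < eps].
      by have /(@cvgrPdist_lt _ R^o)/(_ _ eps0) := @contfun_continuous R M f p.
    apply: sub_finite_set (Bp nf) => i [x Tx] BV.
    move: Tx; rewrite ltNge => /negP; apply.
    apply: (local_embedding_norm_le (TP i)) (ltW eps0) _ _ => m /BV/= /ltW.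
    by rewrite !contfunE mulr1 distrC.
have T'c f : continuous (fun x => f p * phi x + s f x).
  move=> x; apply: cvgD; last exact: sc.
  by apply: cvgM; [exact: cvg_cst|exact: contfun_continuous].
pose T' f := pack_contfun (T'c f).
have T'E f x : T' f x = f p * phi x +
    glue U (fun i => T i (f - f p *: (1 : contfun R M))) (fun=> 0) x by [].
have T'out f x : (forall i, ~ U i x) -> T' f x = f p * phi x.
  by move=> nU; rewrite T'E glue_out// addr0.
have T'in i f x : U i x -> T' f x = T i f x + f p * (1 - T i 1 x).
  move=> Ux; rewrite T'E (glue_in tU _ _ Ux) (phi1 Ux).
  have [Tlin _ _ _ _] := TP i.
  rewrite (addrC f) -scaleNr Tlin !contfunE; ring.
exists T'; split=> // c f g; apply/contfunP => x; rewrite !contfunE.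
have [[i Ux]|/forallNP nU] := pselect (exists i, U i x).
  rewrite !(T'in i)//; have [Tlin _ _ _ _] := TP i.
  rewrite Tlin !contfunE; ring.
rewrite !T'out// !contfunE; ring.
Qed.

End glue_embeddings.

Hypotheses (hK : hausdorff_space K) (cK : compact [set: K]).

(** A Urysohn function u is only known to be 1 at x; truncating 2u at 1 makes it 1 on the whole open
    set where u > 1/2. *)
Lemma compact_bump (U : set K) x : open U -> U x ->
  exists phi : contfun R K, [/\ forall z, 0 <= phi z <= 1,
    forall z, ~ U z -> phi z = 0 & exists V, [/\ open V, V x, V `<=` U &
      forall z, V z -> phi z = 1]].
Proof.
move=> oU Ux.
have nK : normal_space K by exact: compact_normal.
have aK := hausdorff_accessible hK.
have sep : @uniform_separator K (~` U) [set x].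
  move/(@normal_separatorP R): nK; apply; first exact: open_closedC.
    exact: accessible_closed_set1.
  by apply/seteqP; split=> // z [nU /= zx]; apply: nU; rewrite zx.
pose u := @Urysohn K R (~` U) [set x].
have uc : continuous u by exact: Urysohn_continuous.
have u01 z : 0 <= u z <= 1.
  by have /(_ (u z)) := @Urysohn_range K R (~` U) [set x]; rewrite /= in_itv/=; apply; exists z.
have u0 z : ~ U z -> u z = 0 by move=> nU; apply: (Urysohn_sub0 sep); exists z.
have u1 : u x = 1 by apply: (Urysohn_sub1 sep); exists x.
have pc : continuous (fun z => Num.min 1 (2 * u z)).
  apply: min_fun_continuous; first by move=> z; exact: cvg_cst.
  by move=> z; apply: cvgM; [exact: cvg_cst|exact: uc].
pose phi := pack_contfun pc.
have phiE z : phi z = Num.min 1 (2 * u z) by [].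
exists phi; split=> [z|z /u0 uz|].
- have /andP[? _] := u01 z; rewrite phiE ge_min lexx/= le_min ler01/=.
  by rewrite mulr_ge0.
- by rewrite phiE uz mulr0 min_r.
- exists [set z | 2^-1 < u z]; split=> [||z /= zu|z /= zu].
  + rewrite (_ : [set y | _] = u @^-1` [set x | 2^-1 < x])//.
    by apply: open_comp; [move=> y _; exact: uc|exact: open_gt].
  + by rewrite /= u1; lra.
  + by apply: contrapT => /u0 uz; move: zu; rewrite uz; lra.
  + by rewrite phiE min_l//; lra.
Qed.

Lemma block_local_embedding a B p x (U : set K) :
  block a B p -> CB_derivative K a x -> open U -> U x ->
  exists T, local_embedding B U T.
Proof.
move=> bB; elim: bB x U => {a B p} [p _|a p e B q bB IH _ Bp tB Bcvg ea _] x U xa oU Ux.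
  have [phi [phi01 phi0 [V [_ Vx _ phi1]]]] := compact_bump oU Ux.
  exists (fun f => f p *: phi); split=> [c f g|f z /phi0|f fp z|z|_ ->].
  - by apply/contfunP => z; rewrite !contfunE; ring.
  - by rewrite contfunE => ->; rewrite mulr0.
  - by rewrite contfunE mulr_ge0 ?fp//; have /andP[] := phi01 z.
  - by rewrite !contfunE mul1r; have /andP[] := phi01 z.
  - by exists x => // f; rewrite contfunE phi1// mulr1.
have [phi [phi01 phi0 [V [oV Vx VU phi1]]]] := compact_bump oU Ux.
(* The [W n] lie in V, where phi is 1, as gluing demands. The point x is in V but in no [W n], so
   evaluation at x represents p. *)
have [W [oW WV Wx tW WCB]] := CB_derivative_disjoint_open hK xa ea oV Vx.
have /choice[T TP] : forall n, exists T, local_embedding (B n) (W n) T.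
  by move=> n; have [y [yCB Wy]] := WCB n; apply: IH yCB (oW n) Wy.
have [||T' [T'lin T'out T'in]] := glue_embeddings oW tW TP _ _ (p := p) (phi := phi).
- move=> X /Bcvg[N BX]; apply: sub_finite_set (finite_II N) => n /= nB.
  by rewrite ltnNge; apply/negP => /BX.
- by move=> n z /WV/phi1.
exists T'; split=> // [f z nUz|f fB z|z|q' [->|[n _ Bq]]].
- rewrite T'out; first by rewrite phi0// mulr0.
  by move=> n /WV/VU.
- have fp : 0 <= f p by apply: fB; left.
  have [[n Wz]|/forallNP nW] := pselect (exists n, W n z).
    rewrite (T'in n)//; have [_ _ Tpos T1 _] := TP n.
    rewrite addr_ge0 ?mulr_ge0 ?subr_ge0 ?T1//; apply: Tpos => m Bm.
    by apply: fB; right; exists n.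
  by rewrite T'out// mulr_ge0//; have /andP[] := phi01 z.
- have [[n Wz]|/forallNP nW] := pselect (exists n, W n z).
    by rewrite (T'in n)// contfunE mul1r addrC subrK.
  by rewrite T'out// contfunE mul1r; have /andP[] := phi01 z.
- by exists x => // f; rewrite T'out// phi1// mulr1.
- have [_ _ _ _ /(_ _ Bq)[y Wy Ty]] := TP n.
  exists y; first exact/VU/(WV n).
  by move=> f; rewrite (T'in n)// !Ty contfunE subrr mulr0 addr0.
Qed.

Lemma family_positive_embedding a (L : topologicalType) (l : L) (G : Type)
    (j : G -> L -> M) p (U : G -> set K) :
  compact [set: M] -> [set: K] !=set0 -> block a [set: L] l -> limit_family j p ->
  (exists g x, j g x = p) \/ ~ finite_set [set: G] ->
  (forall g, open (U g)) -> trivIset [set: G] U ->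
  (forall g, CB_derivative K a `&` U g !=set0) ->
  embeds_positively_isometrically R M K.
Proof.
move=> cM K0 bl [jdisj jcont jclopen jM jcvg] jp oU tU UCB.
have /choice[T TP] : forall g, exists T, local_embedding (range (j g)) (U g) T.
  move=> g; have [y [yCB Uy]] := UCB g; have [jinj jc] := jcont g.
  by apply: block_local_embedding yCB (oU g) Uy; exact: (block_image jinj jc (jclopen g) bl).
have phi1 g y : U g y -> (1 : contfun R K) y = 1 by [].
have [T' [T'lin T'out T'in]] := glue_embeddings oU tU TP jcvg phi1.
have T'pos f : (forall m, 0 <= f m) -> forall y, 0 <= T' f y.
  move=> f0 y; have [[g Uy]|/forallNP nU] := pselect (exists g, U g y).
    rewrite (T'in g)//; have [_ _ Tpos T1 _] := TP g.
    by rewrite addr_ge0 ?mulr_ge0 ?subr_ge0 ?T1//; apply: Tpos.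
  by rewrite T'out// contfunE mulr1.
have T'1 y : T' 1 y = 1.
  have [[g Uy]|/forallNP nU] := pselect (exists g, U g y).
    by rewrite (T'in g)// contfunE mul1r addrC subrK.
  by rewrite T'out// contfunE mulr1.
have T'range g x : exists y, forall f, T' f y = f (j g x).
  have [_ _ _ _ /(_ (j g x))[|y Uy Ty]] := TP g; first by exists x.
  by exists y => f; rewrite (T'in g)// !Ty contfunE subrr mulr0 addr0.
have T'norming m : exists y, forall f, T' f y = f m.
  have [->|[g [x ->]]] := jM m; last exact: T'range.
  (* If p lies in no copy, the family is infinite, and compactness of K yields a point outside all
     [U g], where [T' f] equals f(p). *)
  case: jp => [[g [x <-]]|infG]; first exact: T'range.
  have KU g : [set: G] g -> [set: K] `&` U g !=set0.
    by move=> _; have [y [_ Uy]] := UCB g; exists y.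
  have [y _ nU] := compact_disjoint_open cK infG (fun g _ => oU g) tU KU.
  by exists y => f; rewrite T'out ?contfunE ?mulr1// => g; exact: nU.
pose T'L := GRing.isLinear.Build R (contfun R M) (contfun R K) *:%R T' T'lin.
pose TT : {linear contfun R M -> contfun R K} := HB.pack T' T'L.
exists TT; split=> // f.
have M0 : [set: M] !=set0 by exists p.
(* Viewing [T'] as a local embedding of the whole space makes the general norm bound available. *)
have le_T' : local_embedding setT setT T'.
  split=> // [f' y []//|f' f0 y|y|q _]; first by apply: T'pos => m; exact: f0.
    by rewrite T'1.
  by have [y Ty] := T'norming q; exists y.
have [m [-> fm]] := sup_norm_attained cM f M0.
apply/le_anti/andP; split; last first.
  by have [y <-] := T'norming m; exact: (sup_norm_ge cK (T' f) y).
apply: sup_norm_le => // y.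
exact: (local_embedding_norm_le le_T' _ (fun m _ => fm m)).
Qed.

End local_embeddings.

(** * From cellular families to continuous surjections *)

Section continuous_surjections.
Variables (M K : topologicalType).
Hypotheses (hK : hausdorff_space K) (cK : compact [set: K]) (zK : zero_dim K).

Lemma zero_dim_clopen (U : set K) x : open U -> U x ->
  exists V, [/\ clopen V, V x & V `<=` U].
Proof.
move=> oU Ux; have [B Bclopen [_ /(_ x) Bx]] := zK.
have [V [BV Vx] VU] := Bx U (open_nbhs_nbhs (conj oU Ux)).
by exists V; split=> //; exact: Bclopen.
Qed.

(** Applying induction to clopen [V n] inside the [W n] makes the n-th map cover [B n] from [V n]
    alone, so its values elsewhere can be replaced by p. The point x is in no [V n] and is sent to
    p. *)
Lemma block_surjection a (B : set M) p x (U : set K) :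
  block a B p -> CB_derivative K a x -> open U -> U x ->
  exists2 h : K -> M, continuous h & h @` U = B.
Proof.
move=> bB; elim: bB x U => {a B p} [p _|a p e B q bB IH _ Bp tB Bcvg ea _] x U xa oU Ux.
  exists (fun=> p); first by move=> z; exact: cvg_cst.
  by apply/seteqP; split=> [_ [z _ <-]//|_ ->]; exists x.
have [W [oW WU Wx tW WCB]] := CB_derivative_disjoint_open hK xa ea oU Ux.
have /choice[V VP] : forall n, exists V, [/\ clopen V, V `<=` W n &
    CB_derivative K (e n) `&` V !=set0].
  move=> n; have [y [yCB Wy]] := WCB n.
  by have [V [cV Vy VW]] := zero_dim_clopen (oW n) Wy; exists V; split=> //; exists y.
have /choice[h hP] : forall n, exists h : K -> M, continuous h /\ h @` V n = B n.
  move=> n; have [[oV _] VW [y [yCB Vy]]] := VP n.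
  by have [h hc hV] := IH n y (V n) yCB oV Vy; exists h.
have oV n : open (V n) by have [[]] := VP n.
have VW n : V n `<=` W n by have [_] := VP n.
have tV : trivIset [set: nat] V.
  by move=> m n _ _ [z [/VW mz /VW nz]]; apply: tW => //; exists z.
exists (glue V h (fun=> p)).
  apply: glue_clopen_continuous => // [n|n|X /Bcvg[N BX]].
  - by have [[]] := VP n.
  - exact: (hP n).1.
  - apply: sub_finite_set (finite_II N) => n /=; rewrite (hP n).2 => nB.
    by rewrite ltnNge; apply/negP => /BX.
apply/seteqP; split=> [_ [z _ <-]|m [->|[n _]]].
- have [[n Vz]|/forallNP nV] := pselect (exists n, V n z).
    right; exists n => //; rewrite (glue_in tV _ _ Vz) -(hP n).2.
    by exists z.
  by left; rewrite glue_out.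
- by exists x => //; rewrite glue_out// => n /VW; exact: Wx.
- rewrite -(hP n).2 => -[z Vz <-]; exists z; first exact/WU/VW/Vz.
  by rewrite (glue_in tV _ _ Vz).
Qed.

Lemma family_surjection a (L : topologicalType) (l : L) (G : Type)
    (j : G -> L -> M) p (U : G -> set K) :
  block a [set: L] l -> limit_family j p ->
  (exists g x, j g x = p) \/ ~ finite_set [set: G] ->
  (forall g, open (U g)) -> trivIset [set: G] U ->
  (forall g, CB_derivative K a `&` U g !=set0) ->
  maps_continuously_onto K M.
Proof.
move=> bl [jdisj jcont jclopen jM jcvg] jp oU tU UCB.
have /choice[V VP] : forall g, exists V, [/\ clopen V, V `<=` U g &
    CB_derivative K a `&` V !=set0].
  move=> g; have [y [yCB Uy]] := UCB g.
  by have [V [cV Vy VU]] := zero_dim_clopen (oU g) Uy; exists V; split=> //; exists y.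
have /choice[h hP] : forall g, exists h : K -> M, continuous h /\ h @` V g = range (j g).
  move=> g; have [[oV _] _ [y [yCB Vy]]] := VP g; have [jinj jc] := jcont g.
  have [h hc hV] := block_surjection (block_image jinj jc (jclopen g) bl) yCB oV Vy.
  by exists h.
have oV g : open (V g) by have [[]] := VP g.
have tV : trivIset [set: G] V.
  move=> g g' _ _ [z [gz gz']]; apply: tU => //.
  by exists z; split; [have [_ + _] := VP g|have [_ + _] := VP g']; exact.
exists (glue V h (fun=> p)); split.
  apply: glue_clopen_continuous => // [g|g|X /jcvg].
  - by have [[]] := VP g.
  - exact: (hP g).1.
  - by apply: sub_finite_set => g /=; rewrite (hP g).2.
have hrange g x : exists z, glue V h (fun=> p) z = j g x.
  have : range (j g) (j g x) by exists x.
  by rewrite -(hP g).2 => -[z Vz <-]; exists z; rewrite (glue_in tV _ _ Vz).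
move=> m; have [->|[g [x ->]]] := jM m; last exact: hrange.
case: jp => [[g [x jgx]]|infG]; first by have [z] := hrange g x; rewrite jgx; exists z.
have KV g : [set: G] g -> [set: K] `&` V g !=set0.
  by move=> _; have [_ _ [y [_ Vy]]] := VP g; exists y.
have [y _ nV] := compact_disjoint_open cK infG (fun g _ => oV g) tV KV.
by exists y; rewrite glue_out// => g; exact: nV.
Qed.

End continuous_surjections.

Lemma surjection_embeds (R : realType) (M K : topologicalType) :
  maps_continuously_onto K M -> embeds_lattice_algebraically_isometrically R M K.
Proof.
move=> [h [hc hsurj]].
have Tc (f : contfun R M) : continuous (fun x => f (h x)).
  by move=> x; apply: (@continuous_comp _ _ _ h f); [exact: hc|exact: contfun_continuous].
pose T (f : contfun R M) := pack_contfun (Tc f).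
have Tlin : linear T by move=> c f g; apply/contfunP.
pose TL := GRing.isLinear.Build R (contfun R M) (contfun R K) *:%R T Tlin.
pose TT : {linear contfun R M -> contfun R K} := HB.pack T TL.
exists TT; split=> [f|f g|f g].
- rewrite /sup_norm; congr sup; apply/seteqP; split=> _ [x _ <-]; first by exists (h x).
  by have [y <-] := hsurj x; exists y.
- by split; apply/contfunP.
- exact/contfunP.
Qed.

(** A set of sets of cardinality |G| is traded for a family indexed by G; the two agree because
    disjoint nonempty members are distinct for distinct indices. *)
Lemma cellular_familyP (K : topologicalType) (A : set K) (G : Type) :
  (exists U : set (set K),
     [/\ cellular_family U, forall V, U V -> A `&` V !=set0 & ([set: G] #= U)%card]) <->
  (exists u : G -> set K, [/\ forall g, open (u g), trivIset [set: G] u &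
     forall g, A `&` u g !=set0]).
Proof.
split=> [[U [[Uo tU] AU /card_set_bijP[u [uU uinj _]]]]|[u [ou tu Au]]].
  have {}uU g : U (u g) by exact: uU.
  exists u; split=> [g|g h _ _ gh|g]; [exact: (Uo _ (uU g)).1| |exact/AU/uU].
  by apply: uinj; rewrite ?inE//; exact: tU gh.
exists (range u); split.
- split=> [_ [g _ <-]|_ _ [g _ <-] [h _ <-] gh]; last by rewrite (tu g h).
  by split=> //; have [x [_ ux]] := Au g; exists x.
- by move=> _ [g _ <-].
- rewrite card_eq_sym; apply: inj_card_eq => g h _ _ gh; apply: tu => //.
  by rewrite -gh setIid; have [x [_ ux]] := Au g; exists x.
Qed.

Theorem theorem5p1 (R : realType) (K : topologicalType) (alpha : omega1) :
  compact [set: K] -> hausdorff_space K -> [set: K] !=set0 ->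
  exists kappa : Type,
    [/\ is_relative_cellularity (CB_derivative K alpha) kappa,
        is_card_sup (fun G => inhabited G /\
          embeds_positively_isometrically R (K_copies G (itv1_omega_exp alpha)) K)
          kappa,
        is_card_sup (fun G => inhabited G /\
          embeds_isometrically R (K_copies G (itv1_omega_exp alpha)) K)
          kappa &
        zero_dim K ->
          is_card_sup (fun G => inhabited G /\
            maps_continuously_onto K (K_copies G (itv1_omega_exp alpha)))
            kappa /\
          is_card_sup (fun G => inhabited G /\
            embeds_lattice_algebraically_isometrically R
              (K_copies G (itv1_omega_exp alpha)) K)
            kappa].
Proof.
move=> cK hK K0; set L := itv1_omega_exp alpha; set A := CB_derivative K alpha.
have [l bl] := itv1_omega_exp_block alpha.
have L0 : [set: L] !=set0 by exists l.
have cL : compact [set: L] by exact: compact_ord_itv1.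
pose cellular G := exists U : set (set K),
  [/\ cellular_family U, forall V, U V -> A `&` V !=set0 & ([set: G] #= U)%card].
have [kappa kappaP] : exists kappa, is_relative_cellularity A kappa.
  (* Cellular families consist of subsets of K, so the power set bounds their cardinals. *)
  apply: (@is_card_sup_exists _ (set K)) => G [U [_ _ GU]].
  by rewrite (card_le_eql GU); exact: card_leT.
have cell_of_iso G : inhabited G -> embeds_isometrically R (K_copies G L) K -> cellular G.
  move=> iG [T Tiso]; have [j [p [jp [cM _]]]] := K_copies_family cL L0 iG.
  apply/cellular_familyP; apply: (isometric_family_cellular cM cK _ K0 Tiso bl jp).
  by exists p.
have iso_of_pos G : embeds_positively_isometrically R (K_copies G L) K ->
    embeds_isometrically R (K_copies G L) K.
  by move=> [T [Tiso _]]; exists T.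
have pos_of_cell G : inhabited G -> cellular G ->
    embeds_positively_isometrically R (K_copies G L) K.
  move=> iG /cellular_familyP[u [ou tu Au]].
  have [j [p [jp [cM pj]]]] := K_copies_family cL L0 iG.
  exact: family_positive_embedding bl jp pj ou tu Au.
exists kappa; split=> //.
- apply: is_card_sup_inhabited kappaP => G iG; split; first exact: pos_of_cell.
  by move/iso_of_pos/cell_of_iso; exact.
- apply: is_card_sup_inhabited kappaP => G iG; split; last exact: cell_of_iso.
  by move/pos_of_cell => /(_ iG)/iso_of_pos.
move=> zK.
have onto_of_cell G : inhabited G -> cellular G -> maps_continuously_onto K (K_copies G L).
  move=> iG /cellular_familyP[u [ou tu Au]].
  have [j [p [jp [_ pj]]]] := K_copies_family cL L0 iG.
  exact (family_surjection hK cK zK bl jp pj ou tu Au).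
have iso_of_alg G : embeds_lattice_algebraically_isometrically R (K_copies G L) K ->
    embeds_isometrically R (K_copies G L) K.
  by move=> [T [Tiso _ _]]; exists T.
(* For nonempty G the implications run from cellular families to surjections, to lattice and algebra
   isometries, to isometries, and back to cellular families. *)
split; apply: is_card_sup_inhabited kappaP => G iG; split.
- exact: onto_of_cell.
- by move=> /(@surjection_embeds R)/iso_of_alg/cell_of_iso; exact.
- by move=> /(onto_of_cell _ iG)/(@surjection_embeds R).
- by move=> /iso_of_alg/cell_of_iso; exact.
Qed.
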